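(* Any factor of $(\mathcal{H},T)$ is uniquely ergodic. In particular, any minimal dynamical system with quasi-discrete spectrum is uniquely ergodic.
   Context: A dynamical system is a pair $(X,s)$ with $X$ a compact Hausdorff space and $s:X\to X$ a homeomorphism; it is minimal if every orbit $\{s^nx:n\in\mathbb{Z}\}$ is dense. $(Y,t)$ is a factor of $(X,s)$ if there is a continuous surjection $\pi:X\to Y$ with $\pi\circ s=t\circ\pi$. $(X,s)$ is uniquely ergodic if there is exactly one regular Borel probability measure $\mu$ on $X$ with $\mu(s^{-1}(B))=\mu(B)$ for every Borel set $B$. $\mathbb{T}$ is the unit circle in $\mathbb{C}$; $\mathcal{C}(X)$ is the algebra of continuous complex functions on $X$ (supremum norm); $\mathcal{C}(X,\mathbb{T})$ the multiplicative group of continuous functions $X\to\mathbb{T}$; $s^*f=f\circ s$. Let $G_0(X,s)$ be the constant functions $X\to\mathbb{T}$, $G_{m+1}(X,s)=\{g\in\mathcal{C}(X,\mathbb{T}): s^*g=fg\text{ for some }f\in G_m(X,s)\}$, $G(X,s)=\bigcup_{m\ge0}G_m(X,s)$. $(X,s)$ has (topological) quasi-discrete spectrum if the linear span of $G(X,s)$ is dense in $\mathcal{C}(X)$. $\mathbb{N}=\{1,2,\ldots\}$, $\mathbb{Z}_+=\{0,1,\ldots\}$; $\mathbb{T}_Q=\{e^{i2\pi q}:q\in\mathbb{Q}\}$. $H(\mathbb{T})$ is the set of all (not necessarily continuous) group homomorphisms $\mathbb{T}\to\mathbb{T}$, with pointwise multiplication and the topology of pointwise convergence. $\phi^{(j)}$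 denotes the $j$-fold composition of $\phi$ with itself; $s(k,j)$ are the (signed) Stirling numbers of the first kind: $n(n-1)\cdots(n-k+1)=\sum_{j=0}^k s(k,j)n^j$. $\mathcal{H}$ is the set of all $(\phi_k)_{k=0}^\infty\in H(\mathbb{T})^{\mathbb{Z}_+}$ with $\phi_0=\mathrm{id}_{\mathbb{T}}$ and $\phi_k(x^{k!})=\prod_{j=1}^k\phi_1^{(j)}(x^{s(k,j)})$ for all $x\in\mathbb{T}_Q$, $k\in\mathbb{N}$, a compact space in the subspace topology of the product. $T:\mathcal{H}\to\mathcal{H}$ is the homeomorphism $T(\phi_0,\phi_1,\phi_2,\ldots)=(\phi_0,\phi_0\phi_1,\phi_1\phi_2,\ldots)$ (pointwise products). *)

(* Defs.v *)
From HB Require Import structures.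
From mathcomp Require Import all_boot all_order all_algebra.
From mathcomp Require Import all_classical all_reals all_analysis.
From mathcomp Require Import complex.

Set Implicit Arguments.
Unset Strict Implicit.
Unset Printing Implicit Defensive.

Import Order.TTheory GRing.Theory Num.Theory.
Import numFieldNormedType.Exports.

Local Open Scope classical_set_scope.
Local Open Scope ring_scope.
Local Open Scope complex_scope.

(** Topological dynamics.  A [ptopologicalType] is a nonempty topological space
    with a distinguished point, which plays no role below: the library's measures
    live on pointed types. *)

Definition homeomorphism (X : topologicalType) (s : X -> X) : Prop :=
  continuous s /\
  exists s' : X -> X, [/\ continuous s', cancel s s' & cancel s' s].

Definition dynamical_system (X : ptopologicalType) (s : X -> X) : Prop :=
  [/\ compact [set: X], hausdorff_space X & homeomorphism s].

(* For a bijection [s], the point [s^(-n) x] is the [y] with [s^n y = x]. *)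
Definition full_orbit (X : Type) (s : X -> X) (x : X) : set X :=
  [set y | exists n : nat, iter n s x = y \/ iter n s y = x].

Definition minimal_system (X : topologicalType) (s : X -> X) : Prop :=
  forall x, dense (full_orbit s x).

Definition is_factor (X Y : topologicalType) (s : X -> X) (t : Y -> Y) : Prop :=
  exists pi : X -> Y,
    [/\ continuous pi, range pi = [set: Y] & forall x, pi (s x) = t (pi x)].

Definition borelType (X : ptopologicalType) := g_sigma_algebraType (@open X).

Definition regular_measure (R : realType) (X : ptopologicalType)
    (mu : probability (borelType X) R) : Prop :=
  forall B : set (borelType X), measurable B ->
    mu B = ereal_inf [set mu U | U in [set U : set X | open U /\ B `<=` U]] /\
    mu B = ereal_sup [set mu K | K in [set K : set X | compact K /\ K `<=` B]].

Definition invariant_measure (R : realType) (X : ptopologicalType)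
    (s : X -> X) (mu : probability (borelType X) R) : Prop :=
  forall B : set (borelType X), measurable B -> mu (s @^-1` B) = mu B.

(* A library measure is a function on all sets, with arbitrary values outside
   the sigma-algebra, so uniqueness is asserted on measurable sets only. *)
Definition uniquely_ergodic (R : realType) (X : ptopologicalType)
    (s : X -> X) : Prop :=
  exists mu : probability (borelType X) R,
    [/\ regular_measure mu, invariant_measure s mu &
        forall nu : probability (borelType X) R,
          regular_measure nu -> invariant_measure s nu ->
          forall B : set (borelType X), measurable B -> nu B = mu B].

(** The usual topology of the complex numbers, given by the modulus. *)

HB.instance Definition _ (R : realType) := NormedModule.copy R[i] R[i]^o.

Definition circle (R : realType) := set_type [set z : R[i] | `|z| = 1].

HB.instance Definition _ (R : realType) := Choice.on (circle R).
HB.instance Definition _ (R : realType) := Topological.on (circle R).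

Section CircleGroup.
Variable R : realType.
Implicit Types x y z : circle R.

Definition toC x : R[i] := set_val x.

Lemma toC_inj : injective toC.
Proof. exact: val_inj. Qed.

Lemma circle_norm x : `|toC x| = 1.
Proof. exact: (set_mem (valP x)). Qed.

Lemma circle_neq0 x : toC x != 0.
Proof. by rewrite -normr_gt0 circle_norm. Qed.

Definition mk_circle (z : R[i]) (z1 : `|z| = 1) : circle R :=
  exist _ z (mem_set z1).

Lemma circle_mul_subproof x y : `|toC x * toC y| = 1.
Proof. by rewrite normrM !circle_norm mul1r. Qed.

Lemma circle_inv_subproof x : `|(toC x)^-1| = 1.
Proof. by rewrite normfV circle_norm invr1. Qed.

Definition circle_one : circle R := mk_circle (normr1 R[i]).
Definition circle_mul x y : circle R := mk_circle (circle_mul_subproof x y).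
Definition circle_inv x : circle R := mk_circle (circle_inv_subproof x).

Lemma circle_mulA : associative circle_mul.
Proof. by move=> x y z; apply: toC_inj; exact: mulrA. Qed.
Lemma circle_mulC : commutative circle_mul.
Proof. by move=> x y; apply: toC_inj; exact: mulrC. Qed.
Lemma circle_mul1 : left_id circle_one circle_mul.
Proof. by move=> x; apply: toC_inj; exact: mul1r. Qed.
Lemma circle_mulr1 : right_id circle_one circle_mul.
Proof. by move=> x; rewrite circle_mulC circle_mul1. Qed.
Lemma circle_mulV : left_inverse circle_one circle_inv circle_mul.
Proof. by move=> x; apply: toC_inj; exact: (mulVf (circle_neq0 x)). Qed.
Lemma circle_mulrV : right_inverse circle_one circle_inv circle_mul.
Proof. by move=> x; rewrite circle_mulC circle_mulV. Qed.

HB.instance Definition _ := isGroup.Build (circle R)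
  circle_mulA circle_mul1 circle_mulr1 circle_mulV circle_mulrV.

Lemma circle_mulgC : commutative (@monoid.mul (circle R)).
Proof. exact: circle_mulC. Qed.

Lemma circle_mulgACA :
  interchange (@monoid.mul (circle R)) (@monoid.mul (circle R)).
Proof. by move=> x y z t; apply: toC_inj; exact: mulrACA. Qed.

HB.instance Definition _ :=
  SemiGroup.isCommutativeLaw.Build (circle R) (@monoid.mul (circle R)) circle_mulgC.

Definition expgz x (n : int) : circle R :=
  match n with Posz m => (x ^+ m)%g | Negz m => (x ^- m.+1)%g end.

Lemma toC_expgz x n : toC (expgz x n) = toC x ^ n.
Proof.
have toCX m : toC (x ^+ m)%g = toC x ^+ m.
  elim: m => [//|m IH].
  by rewrite expgS exprS -IH.
case: n => m /=; first exact: toCX.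
by rewrite NegzE -exprnN -toCX.
Qed.

Lemma expgzD x (m n : int) : expgz x (m + n) = (expgz x m * expgz x n)%g.
Proof.
by apply: toC_inj; rewrite toC_expgz (expfzDr _ _ (circle_neq0 x)) -!toC_expgz.
Qed.

Lemma expgz0 x : expgz x 0 = 1%g.
Proof. by []. Qed.

Lemma expgzMl x y (n : int) : expgz (x * y)%g n = (expgz x n * expgz y n)%g.
Proof. by apply: toC_inj; rewrite toC_expgz expfzMl -!toC_expgz. Qed.

(* The points exp(2 i pi q) with q rational. *)
Definition circleQ : set (circle R) :=
  [set x | exists q : rat, toC x =
     cos (2 * pi * ratr q : R) +i* sin (2 * pi * ratr q : R)].

End CircleGroup.

(** The compact space of sequences of endomorphisms and its transformation. *)

(* n(n-1)...(n-k+1) as a polynomial in n; its coefficients are the signed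
   Stirling numbers of the first kind. *)
Definition falling_poly (k : nat) : {poly int} :=
  \prod_(i < k) ('X - (i%:R)%:P).

Definition stirling1 (k j : nat) : int := (falling_poly k)`_j.

Section Hseq.
Variable R : realType.
Local Notation T1 := (circle R).

(* The group homomorphisms of the circle, not necessarily continuous. *)
Definition circle_hom : set {ptws T1 -> T1} :=
  [set phi : T1 -> T1 | {morph phi : x y / (x * y)%g}].

Definition Hset : set {ptws nat -> {ptws T1 -> T1}} :=
  [set phi | [/\ forall k, circle_hom (phi k), phi 0%N = id &
     forall (k : nat) (x : T1), (0 < k)%N -> circleQ x ->
       phi k (x ^+ k`!)%g =
       (\prod_(1 <= j < k.+1) iter j (phi 1%N) (expgz x (stirling1 k j)))%g]].

Definition Hspace := set_type Hset.

HB.instance Definition _ := Topological.on Hspace.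

Definition Tseq (phi : {ptws nat -> {ptws T1 -> T1}}) :
    {ptws nat -> {ptws T1 -> T1}} :=
  fun k => match k with
           | 0%N => phi 0%N
           | k'.+1 => fun x => (phi k' x * phi k'.+1 x)%g
           end.

(* [heval phi p] is the value at the endomorphism [phi] of the integer
   polynomial [p], in the endomorphism ring of the circle. *)
Definition heval (phi : T1 -> T1) (p : {poly int}) (x : T1) : T1 :=
  (\prod_(0 <= j < size p) iter j phi (expgz x p`_j))%g.

Section Heval.
Variables (phi : T1 -> T1) (phiM : {morph phi : x y / (x * y)%g}).

Lemma hom1 : phi 1%g = 1%g.
Proof. by apply: (@mulgI _ (phi 1%g)); rewrite -phiM !mulg1. Qed.

Lemma homX x n : phi (x ^+ n)%g = (phi x ^+ n)%g.
Proof. by elim: n => [|n IH]; rewrite ?expg0 ?hom1// !expgS phiM IH. Qed.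

Lemma homV x : phi (x^-1)%g = ((phi x)^-1)%g.
Proof. by apply: (@mulgI _ (phi x)); rewrite -phiM !mulgV hom1. Qed.

Lemma homz x n : phi (expgz x n) = expgz (phi x) n.
Proof. by case: n => m /=; rewrite ?homV homX. Qed.

Lemma iter_hom j : {morph iter j phi : x y / (x * y)%g}.
Proof. by elim: j => // j IH x y; rewrite !iterS IH phiM. Qed.

Lemma iter_hom1 j : iter j phi 1%g = 1%g.
Proof. by elim: j => // j IH; rewrite iterS IH hom1. Qed.

Lemma heval_widen (p : {poly int}) n x : (size p <= n)%N ->
  heval phi p x = (\prod_(0 <= j < n) iter j phi (expgz x p`_j))%g.
Proof.
move=> pn; rewrite (big_cat_nat (n := size p)) //= [X in (_ * X)%g]big1_seq ?mulg1 //.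
move=> j /andP[_]; rewrite mem_index_iota => /andP[pj _].
by rewrite nth_default // expgz0 iter_hom1.
Qed.

Lemma hevalD (p q : {poly int}) x :
  heval phi (p + q) x = (heval phi p x * heval phi q x)%g.
Proof.
pose n := maxn (size p) (size q).
rewrite !(@heval_widen _ n) ?leq_maxl ?leq_maxr //; last first.
  exact: size_polyD.
rewrite -big_split /=; apply: eq_bigr => j _.
by rewrite coefD expgzD iter_hom.
Qed.

Lemma hevalC c x : heval phi c%:P x = expgz x c.
Proof.
rewrite (@heval_widen _ 1) ?size_polyC ?leq_b1 //.
by rewrite big_nat1 coefC eqxx.
Qed.

Lemma hevalMX p x : heval phi (p * 'X) x = heval phi p (phi x).
Proof.
rewrite (@heval_widen _ (size p).+1); last first.
  by rewrite (leq_trans (size_polyMleq _ _)) // size_polyX addn2.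
rewrite big_nat_recl // coefMX eqxx [X in (X * _)%g]expgz0 mul1g /heval.
by apply: eq_bigr => j _; rewrite coefMX /= -iterS iterSr homz.
Qed.

Lemma hevalM p : {morph heval phi p : x y / (x * y)%g}.
Proof.
move=> x y; rewrite /heval -big_split /=; apply: eq_bigr => j _.
by rewrite expgzMl iter_hom.
Qed.

Lemma hevalMn p n x : heval phi (p *+ n) x = (heval phi p x ^+ n)%g.
Proof.
elim: n => [|n IH]; last by rewrite mulrS hevalD IH expgS.
by rewrite mulr0n -[0]/(0%:P) hevalC.
Qed.

End Heval.

Lemma heval_shift (phi : T1 -> T1) (p : {poly int}) x :
  {morph phi : x y / (x * y)%g} ->
  heval (fun y => (y * phi y)%g) p x = heval phi (p \Po ('X + 1)) x.
Proof.
move=> phiM; set psi := fun y => _.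
have psiM : {morph psi : x y / (x * y)%g}.
  by move=> a b; rewrite /psi phiM; exact: circle_mulgACA.
elim/poly_ind: p x => [|p c IH] x.
  by rewrite comp_poly0 -[0]/(0%:P) !hevalC.
rewrite comp_poly_MXaddC mulrDr mulr1 !(hevalD, hevalMX, hevalC) //.
by rewrite !IH hevalM // (circle_mulgC (heval _ _ x)).
Qed.

Lemma falling_polyS k : falling_poly k.+1 = falling_poly k * ('X - (k%:R)%:P).
Proof. by rewrite /falling_poly big_ord_recr. Qed.

Lemma falling_poly_shift k :
  falling_poly k.+1 \Po ('X + 1) = falling_poly k.+1 + falling_poly k *+ k.+1.
Proof.
have -> : falling_poly k.+1 \Po ('X + 1) = falling_poly k * ('X + 1).
  elim: k => [|k IH].
    rewrite falling_polyS /falling_poly big_ord0 !mul1r subr0.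
    exact: comp_polyX.
  rewrite falling_polyS comp_polyM IH falling_polyS comp_polyB comp_polyX.
  rewrite comp_polyC mulrAC; congr (_ * _ * _).
  by rewrite -natr1 polyCD opprD addrACA subrr addr0.
rewrite falling_polyS -(mulr_natr (falling_poly k)) -mulrDr; congr (_ * _).
by rewrite polyC_natr -natr1 addrA subrK.
Qed.

Lemma heval_falling (phi : T1 -> T1) k x : {morph phi : x y / (x * y)%g} ->
  (0 < k)%N -> heval phi (falling_poly k) x =
    (\prod_(1 <= j < k.+1) iter j phi (expgz x (stirling1 k j)))%g.
Proof.
move=> phiM k0.
rewrite (@heval_widen _ _ _ k.+1) //; last first.
  by rewrite size_prod_XsubC [index_enum _]unlock -enumT size_enum_ord.
rewrite big_ltn //= -/(stirling1 k 0) -[X in (X * _)%g]/(expgz x (stirling1 k 0)).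
suff -> : stirling1 k 0 = 0 by rewrite expgz0 mul1g.
case: k k0 => // k _; rewrite /stirling1 /falling_poly big_ord_recl subr0.
by rewrite coefXM.
Qed.

Lemma Tseq_Hset (phi : {ptws nat -> {ptws T1 -> T1}}) :
  Hset phi -> Hset (Tseq phi).
Proof.
move=> [phiM phi0 phiE]; have phi1M := phiM 1%N.
have phiE' k x : circleQ x ->
    phi k (x ^+ k`!)%g = heval (phi 1%N) (falling_poly k) x.
  move=> Qx; case: k => [|k]; last by rewrite phiE // heval_falling.
  by rewrite phi0 /falling_poly big_ord0 -[1]/(1%:P) hevalC.
have T1E : Tseq phi 1%N = fun x => (x * phi 1%N x)%g by rewrite /= phi0.
have TM k : circle_hom (Tseq phi k).
  case: k => [|k]; first exact: phiM.
  move=> x y /=; rewrite !phiM; exact: circle_mulgACA.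
split=> // -[//|k] x _ Qx.
rewrite -heval_falling //; last exact: (TM 1%N).
rewrite T1E heval_shift // falling_poly_shift hevalD // hevalMn //.
rewrite -!phiE' // circle_mulgC /= factS mulnC expgnA.
by rewrite -(homX (phiM k)).
Qed.

Definition Tmap (phi : Hspace) : Hspace :=
  exist _ (Tseq (val phi)) (mem_set (Tseq_Hset (set_mem (valP phi)))).

End Hseq.

(** Topological quasi-discrete spectrum. *)

Section QuasiDiscreteSpectrum.
Variables (R : realType) (X : topologicalType) (s : X -> X).

(* A function [g] in [Gset m] is a quasi-eigenfunction of order [m]. *)
Fixpoint Gset (m : nat) : set (X -> circle R) :=
  match m with
  | 0%N => [set g | exists c, g = cst c]
  | m'.+1 => [set g | continuous g /\
      exists2 f, Gset m' f & forall x, g (s x) = (f x * g x)%g]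
  end.

Definition Gunion : set (X -> circle R) := \bigcup_m Gset m.

Definition linear_span (A : set (X -> circle R)) : set (X -> R[i]) :=
  [set F | exists (n : nat) (c : 'I_n -> R[i]) (g : 'I_n -> X -> circle R),
     (forall i, A (g i)) /\ F = fun x => \sum_(i < n) c i * toC (g i x)].

(* The last inequality is [sup_x |f x - F x| <= e]. *)
Definition quasi_discrete_spectrum : Prop :=
  forall f : X -> R[i], continuous f ->
  forall e : R, 0 < e ->
  exists2 F, linear_span Gunion F & forall x, `|f x - F x| <= e%:C.

End QuasiDiscreteSpectrum.

(* Main.v *)
From HB Require Import structures.
Require Import Defs.
From mathcomp Require Import all_boot all_order all_algebra.
From mathcomp Require Import all_classical all_reals all_analysis.
From mathcomp Require Import measurable_realfun complex ring lra zify.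

(** If for every real continuous [f] the Birkhoff averages of [f] converge at
    every point to one constant [L f], the system is uniquely ergodic: the
    positive functional [L] gives an invariant regular measure by the Riesz
    construction, and by dominated convergence and invariance every invariant
    probability integrates [f] to [L f].  This property of averages passes to
    factors, and by uniform approximation it only has to be checked on characters
    whose linear combinations are dense.

    Along an orbit a character is a polynomial phase [n |-> prod_i z_i ^ C(n, i)].
    If some [z_i] with [i > 0] is not a root of unity, then, taking the last such
    [i], van der Corput's inequality shows by induction on [i] that its averages
    tend to [0].  Otherwise the phase is periodic, and its mean is an invariant
    function of the starting point.  In a minimal system such a function is
    constant; in [Hspace] every point acts on a finite set of roots of unity as
    some [T^a (id, 1, 1, ...)], so the mean is constant there as well.  The
    density of the characters of [Hspace] is the Stone-Weierstrass theorem. *)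

Set Implicit Arguments.
Unset Strict Implicit.
Unset Printing Implicit Defensive.

Import Order.TTheory GRing.Theory Num.Theory numFieldNormedType.Exports.
Import ComplexField.Normc.

Local Open Scope classical_set_scope.
Local Open Scope ring_scope.
Local Open Scope complex_scope.

(** * Van der Corput's theorem *)

Section Averages.
Variable R : realType.
Implicit Types (u v : nat -> R[i]) (z : R[i]).

(** No supply of characters is at hand on a factor, so nothing can be expanded there. This is why
    the criterion speaks of all real continuous functions: they pull back to [Hspace], and the
    characters are used upstairs. Torsion is what complicates the van der Corput induction.
    Coefficients of a phase beyond the last nontorsion one need not vanish, so the degree cannot be
    the induction variable; they are instead killed by passing to [d]-th powers, and a root of unity
    left over is recovered through a period that is a power of [d]. On [Hspace] the Stirling
    relation replaces minimality. If [phi_1] acts on a root of unity [w] as the power [a], the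
    relation reads [phi_k (w^(k!)) = w^(a(a-1)...(a-k+1))], so one integer [a] governs all [phi_k]
    on roots of unity, with [phi_k] acting as the power [C(a, k)]. *)

Lemma normc_ge0 z : 0 <= normc z.
Proof. by case: z => a b; exact: sqrtr_ge0. Qed.

Lemma sqr_normcE z : normc z ^+ 2 = complex.Re (z * z^*).
Proof.
case: z => a b /=; rewrite sqr_sqrtr ?addr_ge0 ?sqr_ge0//.
by rewrite mulrN opprK -!expr2.
Qed.

Lemma normcJ z : normc z^* = normc z.
Proof. by case: z => a b /=; rewrite sqrrN. Qed.

Lemma ge_Re_normc z : `|complex.Re z| <= normc z.
Proof.
case: z => a b /=; rewrite -sqrtr_sqr ler_sqrt ?addr_ge0 ?sqr_ge0//.
by rewrite lerDl sqr_ge0.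
Qed.

Lemma normc_real (x : R) : normc x%:C = `|x|.
Proof. by rewrite /= expr0n addr0 sqrtr_sqr. Qed.

Lemma normc_sum (I : Type) (r : seq I) (P : pred I) (F : I -> R[i]) :
  normc (\sum_(i <- r | P i) F i) <= \sum_(i <- r | P i) normc (F i).
Proof.
elim/big_ind2: _ => //; first by rewrite normc0.
by move=> a x b y ha hb; apply: (le_trans (le_normcD _ _)); exact: lerD.
Qed.

(** Convergence of the Cesaro means to 0, with the division cleared so that [N = 0] is harmless. *)
Definition mean_zero u : Prop :=
  forall e : R, 0 < e ->
  exists N0, forall N, (N0 <= N)%N -> normc (\sum_(n < N) u n) <= e * N%:R.

Lemma eq_mean_zero u v : u =1 v -> mean_zero u -> mean_zero v.
Proof. by move=> /funext ->. Qed.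

Lemma mean_zeroD u v : mean_zero u -> mean_zero v ->
  mean_zero (fun n => u n + v n).
Proof.
move=> u0 v0 e e0; have e20 : 0 < e / 2 by lra.
have [N1 h1] := u0 _ e20; have [N2 h2] := v0 _ e20.
exists (maxn N1 N2) => N; rewrite geq_max => /andP[/h1 a /h2 b].
rewrite big_split /=; apply: (le_trans (le_normcD _ _)).
by apply: (le_trans (lerD a b)); rewrite -mulrDl -splitr.
Qed.

Lemma mean_zeroZ c u : mean_zero u -> mean_zero (fun n => c * u n).
Proof.
move=> u0 e e0; have c0 := normc_ge0 c.
have [N0 h] := u0 (e / (normc c + 1)) (ltac:(apply: divr_gt0 => //; lra)).
exists N0 => N /h {}h; rewrite -mulr_sumr normcM.
apply: (le_trans (ler_wpM2l c0 h)).
rewrite mulrA ler_wpM2r// mulrCA ler_piMr ?(ltW e0)//.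
by rewrite ler_pdivrMr ?mul1r; lra.
Qed.

Lemma mean_zero_sum (I : Type) (r : seq I) (P : pred I) (F : I -> nat -> R[i]) :
  (forall i, P i -> mean_zero (F i)) ->
  mean_zero (fun n => \sum_(i <- r | P i) F i n).
Proof.
move=> F0; elim: r => [|i r IH].
  apply: (@eq_mean_zero (fun=> 0)) => [n|e e0]; first by rewrite big_nil.
  by exists 0%N => N _; rewrite big1// normc0 mulr_ge0// ltW.
have [Pi|nPi] := boolP (P i); last first.
  by apply: eq_mean_zero IH => n; rewrite big_cons (negbTE nPi).
apply: eq_mean_zero (mean_zeroD (F0 _ Pi) IH) => n.
by rewrite big_cons Pi.
Qed.

Lemma mean_zero_conj u : mean_zero u -> mean_zero (fun n => (u n)^*).
Proof.
move=> u0 e /u0[N0 h]; exists N0 => N /h.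
by rewrite -rmorph_sum normcJ.
Qed.

Lemma mean_zero_bounded u (B : R) :
  (forall N, normc (\sum_(n < N) u n) <= B) -> mean_zero u.
Proof.
move=> uB e e0; have B0 : 0 <= B by apply: le_trans (uB 0%N); exact: normc_ge0.
exists (Num.bound (B / e)) => N hN; apply: (le_trans (uB N)).
rewrite mulrC -ler_pdivrMr//; apply: (le_trans (ltW (archi_boundP _))).
  by rewrite divr_ge0// ltW.
by rewrite ler_nat.
Qed.

(** A shift by one telescopes to two boundary terms, bounded by [B + B]; a shift by [k] is a sum of
    [k] of these. *)
Lemma mean_zero_shift_diff u (B : R) k : (forall n, normc (u n) <= B) ->
  mean_zero (fun n => u (n + k)%N - u n).
Proof.
move=> uB; elim: k => [|k IH].
  apply: (@mean_zero_bounded _ 0) => N.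
  by rewrite big1 ?normc0// => i _; rewrite addn0 subrr.
apply: (@eq_mean_zero
    (fun n => (u (n + k.+1)%N - u (n + k)%N) + (u (n + k)%N - u n))).
  by move=> n; rewrite addrA subrK.
apply: mean_zeroD => //; apply: (@mean_zero_bounded _ (B + B)) => N.
rewrite -(big_mkord xpredT (fun n => u (n + k.+1)%N - u (n + k)%N)).
under eq_bigr do rewrite addnS -addSn.
rewrite (telescope_sumr (fun n => u (n + k)%N))//.
by apply: (le_trans (le_normcD _ _)); rewrite normcN lerD.
Qed.

Lemma mean_zero_shift u (B : R) k : (forall n, normc (u n) <= B) ->
  mean_zero u -> mean_zero (fun n => u (n + k)%N).
Proof.
move=> uB u0; apply: eq_mean_zero (mean_zeroD (mean_zero_shift_diff k uB) u0).
by move=> n; rewrite subrK.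
Qed.

(** The shift difference by [N] is [(z - 1) * u n], and [z - 1] is invertible. *)
Lemma mean_zero_quasiperiodic u (B : R) N z : (forall n, normc (u n) <= B) ->
  z != 1 -> (forall n, u (n + N)%N = z * u n) -> mean_zero u.
Proof.
move=> uB z1 uN; have := mean_zero_shift_diff N uB.
move=> /(mean_zeroZ (z - 1)^-1); apply: eq_mean_zero => n.
by rewrite uN -{2}(mul1r (u n)) -mulrBl mulrA mulVf ?mul1r// subr_eq0.
Qed.

(** Summing the shift differences over one window leaves [- N * u n], because the window sum itself
    is 0. *)
Lemma mean_zero_periodic u (B : R) N : (0 < N)%N -> (forall n, normc (u n) <= B) ->
  (forall n, \sum_(k < N) u (n + k)%N = 0) -> mean_zero u.
Proof.
move=> N0 uB uN.
have /(mean_zeroZ (- N%:R^-1)) : mean_zero (fun n => \sum_(k < N) (u (n + k)%N - u n)).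
  by apply: mean_zero_sum => k _; exact: mean_zero_shift_diff uB.
apply: eq_mean_zero => n; rewrite sumrB uN sumr_const card_ord sub0r.
by rewrite mulrNN -[u n *+ N]mulr_natl mulKf// pnatr_eq0 -lt0n.
Qed.

Lemma sqr_sum_le (N : nat) (a : nat -> R) :
  (\sum_(n < N) a n) ^+ 2 <= N%:R * \sum_(n < N) a n ^+ 2.
Proof.
elim: N => [|N IH]; first by rewrite !big_ord0 expr0n mulr0.
rewrite !big_ord_recr /=; set S := \sum_(_ < _) _ in IH *.
set Q := \sum_(_ < _) _ in IH *; set b := a N.
suff : 2 * S * b <= Q + N%:R * b ^+ 2.
  by rewrite -[N.+1%:R]natr1; move: IH; move: (N%:R) => M; nra.
(* Expanding this sum of squares gives exactly the bound on the cross term [2 * S * b]. *)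
have : 0 <= \sum_(n < N) (a n - b) ^+ 2 by apply: sumr_ge0 => n _; exact: sqr_ge0.
rewrite (eq_bigr (fun n : 'I_N => (a n ^+ 2 + b ^+ 2) - (2 * b) * a n)); last first.
  by move=> n _; ring.
rewrite sumrB big_split /= -[X in _ - X]mulr_sumr sumr_const card_ord.
rewrite -[b ^+ 2 *+ N]mulr_natl -/S -/Q.
move: (N%:R) => M; nra.
Qed.

(** Up to an error [o(N)], [H] times the sum of [u] is the sum of the window sums [w n]. By
    Cauchy-Schwarz it suffices to bound the sum of [|w n|^2]: its diagonal terms contribute at most
    [H] for each [n], and its off-diagonal terms [q] are correlations of mean zero. *)
Lemma mean_zero_van_der_corput u : (forall n, normc (u n) <= 1) ->
  (forall h, (0 < h)%N -> mean_zero (fun n => u (n + h)%N * (u n)^*)) ->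
  mean_zero u.
Proof.
move=> u1 uh.
have uu1 a b : normc (u a * (u b)^*) <= 1.
  by rewrite normcM normcJ mulr_ile1// normc_ge0.
have uhh h k : h != k -> mean_zero (fun n => u (n + h)%N * (u (n + k)%N)^*).
  wlog : h k / (k < h)%N => [th|kh _].
    rewrite neq_ltn => /orP[hk|kh]; last by apply: th; rewrite ?gtn_eqF.
    apply: eq_mean_zero (mean_zero_conj (th _ _ hk _)); last by rewrite gtn_eqF.
    by move=> n; rewrite rmorphM /= conjcK mulrC.
  have hk0 : (0 < h - k)%N by rewrite subn_gt0.
  apply: eq_mean_zero (@mean_zero_shift _ 1 k _ (uh _ hk0)) => n //.
  by rewrite -addnA subnKC// ltnW.
move=> e e0.
(* Cauchy-Schwarz will give [2 * H * N^2], which has to stay below [(e / 2 * H * N)^2]; this asks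
   for [8 <= e^2 * H]. *)
pose H := (Num.bound (8 / e ^+ 2)).+1.
have H8 : 8 <= e ^+ 2 * H%:R.
  rewrite mulrC -ler_pdivrMr ?exprn_gt0//; apply: ltW.
  apply: lt_le_trans (archi_boundP _) _; first by rewrite divr_ge0 ?sqr_ge0.
  by rewrite ler_nat leqnSn.
have H0 : 0 < H%:R :> R by rewrite ltr0n.
pose w n := \sum_(h < H) u (n + h)%N.
pose q n := \sum_(h < H) \sum_(k < H | k != h) u (n + h)%N * (u (n + k)%N)^*.
have q0 : mean_zero q.
  apply: mean_zero_sum => h _; apply: mean_zero_sum => k kh; apply: uhh.
  by rewrite eq_sym.
have w0 : mean_zero (fun n => \sum_(h < H) (u (n + h)%N - u n)).
  by apply: mean_zero_sum => h _; exact: mean_zero_shift_diff u1.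
have wE n : normc (w n) ^+ 2 <= H%:R + complex.Re (q n).
  rewrite sqr_normcE {1}/w mulr_suml /q !raddf_sum /=.
  rewrite -[X in X%:R](card_ord H) -sumr_const -big_split; apply: ler_sum => h _ /=.
  rewrite mulr_sumr (bigD1 h) //= raddfD /= lerD2r.
  exact: le_trans (ler_norm _) (le_trans (ge_Re_normc _) (uu1 _ _)).
have [N1 h1] := q0 _ H0.
have [N2 h2] := w0 (e / 2 * H%:R) (ltac:(apply: mulr_gt0 => //; lra)).
exists (maxn N1 N2) => N; rewrite geq_max => /andP[/h1 {}h1 /h2 {}h2].
have N0 : 0 <= N%:R :> R by [].
have wN : normc (\sum_(n < N) w n) <= e / 2 * H%:R * N%:R.
  rewrite -(@ler_pXn2r _ 2) ?nnegrE ?normc_ge0//; last first.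
    by rewrite !mulr_ge0// ltW//; lra.
  apply: (@le_trans _ _ ((\sum_(n < N) normc (w n)) ^+ 2)).
    by rewrite ler_pXn2r ?nnegrE ?normc_ge0 ?sumr_ge0// ?normc_sum// => n _; exact: normc_ge0.
  apply: (le_trans (sqr_sum_le N (fun n => normc (w n)))).
  apply: (@le_trans _ _ (N%:R * (2 * H%:R * N%:R))).
    rewrite ler_wpM2l//.
    apply: (@le_trans _ _ (\sum_(n < N) (H%:R + complex.Re (q n)))).
      by apply: ler_sum => n _.
    rewrite big_split /= sumr_const card_ord -[X in _ + X](raddf_sum (@complex.Re R)) /=.
    rewrite -mulr_natr.
    have := le_trans (le_trans (ler_norm _) (ge_Re_normc _)) h1.
    by lra.
  rewrite [leRHS](_ : _ = N%:R * (H%:R * (e ^+ 2 * H%:R / 4) * N%:R)); last by field.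
  by rewrite ler_wpM2l// ler_wpM2r//; nra.
rewrite -(ler_pM2l H0).
have -> : H%:R * normc (\sum_(n < N) u n) = normc (H%:R * \sum_(n < N) u n).
  by rewrite normcM -(rmorph_nat (real_complex R)) normc_real normr_nat.
have -> : H%:R * \sum_(n < N) u n =
    \sum_(n < N) w n - \sum_(n < N) \sum_(h < H) (u (n + h)%N - u n).
  rewrite -sumrB mulr_sumr; apply: eq_bigr => n _.
  by rewrite sumrB sumr_const card_ord opprB addrC subrK mulr_natl.
apply: (le_trans (le_normcD _ _)); rewrite normcN.
by apply: (le_trans (lerD wN h2)); rewrite le_eqVlt; apply/orP; left; apply/eqP; field.
Qed.

End Averages.

(** * Polynomial phases on the circle *)

Section CircleTheory.
Variable R : realType.
Implicit Types x y : circle R.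

Lemma toCM x y : toC (x * y)%g = toC x * toC y.
Proof. by []. Qed.

Lemma toCX x n : toC (x ^+ n)%g = toC x ^+ n.
Proof. exact: (toC_expgz x (Posz n)). Qed.

Lemma normc_toC x : normc (toC x) = 1.
Proof. by have := circle_norm x => -[]. Qed.

Lemma toCV x : toC (x^-1)%g = (toC x)^*.
Proof.
apply: (mulfI (circle_neq0 x)).
by rewrite -sqr_normc circle_norm expr1n mulfV ?circle_neq0.
Qed.

Lemma circle_expgM x y n : ((x * y) ^+ n = x ^+ n * y ^+ n)%g.
Proof. by apply: toC_inj; rewrite toCM !toCX toCM exprMn. Qed.

Definition nontorsion x := forall n, (0 < n)%N -> (x ^+ n)%g <> 1%g.

End CircleTheory.

Section PhaseSequences.
Variable R : realType.
Implicit Type f : nat -> nat -> circle R.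

(** Pascal's recursion: if [f i] is trivial for large [i], then [f 0 n] is the product of the
    [f i 0 ^ C(n, i)]. Carrying all the differences along keeps binomial exponents out of the
    proofs. *)
Definition phase_sequence f := forall i n, f i n.+1 = (f i n * f i.+1 n)%g.

Lemma phase_torsion_const f d i : phase_sequence f ->
  (forall n, f i.+1 n ^+ d = 1)%g -> forall n, (f i n ^+ d = f i 0 ^+ d)%g.
Proof.
by move=> fS fd; elim=> // n IH; rewrite fS circle_expgM fd mulg1 IH.
Qed.

Lemma phase_torsion_linear f d i : phase_sequence f ->
  (forall n, f i.+2 n ^+ d = 1)%g ->
  forall n, (f i n ^+ d = f i 0 ^+ d * (f i.+1 0 ^+ d) ^+ n)%g.
Proof.
move=> fS fd; elim=> [|n IH]; first by rewrite expg0 mulg1.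
by rewrite fS circle_expgM IH (phase_torsion_const fS fd) -mulgA expgSr.
Qed.

Lemma phase_quasiperiodic f N i : phase_sequence f ->
  (forall n, f i.+1 (n + N)%N = f i.+1 n) ->
  forall n, f i (n + N)%N = ((f i N * (f i 0)^-1) * f i n)%g.
Proof.
move=> fS fN; elim=> [|n IH]; first by rewrite -mulgA mulVg mulg1.
by rewrite addSn !fS fN IH mulgA.
Qed.

(** Descent from [K]: if [f i.+1] has period [d ^ m], then [f i] is multiplied by a fixed [w] over
    that period. As [f i ^ d] is constant, [w ^ d = 1], so [d ^ m.+1] is a period of [f i]. *)
Lemma phase_periodic f d j K : phase_sequence f ->
  (forall i n, (K < i)%N -> f i n = 1%g) ->
  (forall i n, (j < i)%N -> (f i n ^+ d)%g = 1%g) ->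
  forall m i, (j <= i)%N -> (K < i + m)%N ->
  forall n, f i (n + d ^ m)%N = f i n.
Proof.
move=> fS fK fd; elim=> [|m IH] i ji Kim n.
  by rewrite addn0 in Kim; rewrite !fK.
have fN := IH i.+1 (leqW ji) (ltac:(by rewrite addSnnS)).
have fq := phase_quasiperiodic fS fN.
set w := (f i _ * _)%g in fq.
have wd : (w ^+ d = 1)%g.
  apply: (@mulIg _ (f i 0 ^+ d)%g).
  rewrite -circle_expgM /w -mulgA mulVg mulg1 mul1g.
  by apply: phase_torsion_const => // k; exact: fd.
suff H k : f i (n + d ^ m * k)%N = (w ^+ k * f i n)%g.
  by rewrite expnSr H wd mul1g.
elim: k => [|k IHk]; first by rewrite muln0 addn0 expg0 mul1g.
by rewrite mulnS addnCA addnC fq IHk expgS mulgA.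
Qed.

(** For [j = 0] the phase is quasiperiodic with a multiplier different from 1. Otherwise the
    quotient by the shift by [h] is a phase sequence whose terms from index [j.+2] on are
    [d]-torsion, so the last nontorsion index drops by one and van der Corput applies. *)
Lemma phase_mean_zero f d j K : (0 < d)%N -> phase_sequence f ->
  (forall i n, (K < i)%N -> f i n = 1%g) ->
  (forall i n, (j.+1 < i)%N -> (f i n ^+ d)%g = 1%g) ->
  nontorsion (f j.+1 0) -> mean_zero (fun n => toC (f 0 n)).
Proof.
move=> d0; elim: j f => [|j IH] f fS fK fd fj.
  have fN := phase_periodic fS fK fd (leqnn 1%N) (m := K) (ltac:(by [])).
  have fq := phase_quasiperiodic fS fN.
  apply: (@mean_zero_quasiperiodic _ (fun n => toC (f 0%N n)) 1 (d ^ K)%N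
            (toC (f 0%N (d ^ K)%N * (f 0%N 0%N)^-1)%g)) => [n||n].
  - by rewrite normc_toC.
  (* With multiplier 1, [f 0] would agree at [0] and [d ^ K], whereas its [d]-th powers there differ
     by the factor [(f 1 0 ^ d) ^ (d ^ K)]; then [f 1 0] would be torsion. *)
  - apply/eqP => w1; have {}w1 : (f 0%N (d ^ K)%N * (f 0%N 0%N)^-1)%g = 1%g.
      exact: toC_inj.
    have := phase_torsion_linear fS (fun n => fd 2 n (ltnSn 1)) (d ^ K).
    have -> : f 0%N (d ^ K)%N = f 0%N 0%N.
      by rewrite -[LHS](mulgVK (f 0%N 0%N)) w1 mul1g.
    rewrite -[LHS]mulg1 => /mulgI /esym; rewrite -expgnA.
    by apply: fj; rewrite muln_gt0 d0 expn_gt0 d0.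
  - by rewrite fq.
apply: mean_zero_van_der_corput => [n|h h0]; first by rewrite normc_toC.
pose g i n := (f i (n + h)%N * (f i n)^-1)%g.
apply: (@eq_mean_zero _ (fun n => toC (g 0%N n))).
  by move=> n; rewrite /g toCM toCV.
have fc i n : (j.+1 < i)%N -> (f i n ^+ d = f i 0 ^+ d)%g.
  by move=> ji; apply: phase_torsion_const => // k; exact: fd.
apply: IH => [i n|i n Ki|i n ji|N N0].
- rewrite /g addSn !fS; apply: toC_inj; rewrite !(toCM, toCV) rmorphM /=; ring.
- by rewrite /g !fK// mulgV.
- apply: (@mulIg _ (f i n ^+ d)%g); rewrite -circle_expgM mul1g /g mulgVK.
  by rewrite fc// [in RHS]fc.
(* The new leading coefficient is, up to [d]-torsion, the old one to the power [h > 0], hence still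
   nontorsion. *)
- move=> gN; have : (g j.+1 0 ^+ d = (f j.+2 0 ^+ d) ^+ h)%g.
    apply: (@mulIg _ (f j.+1 0 ^+ d)%g); rewrite -circle_expgM /g mulgVK add0n.
    rewrite [RHS]circle_mulgC; apply: phase_torsion_linear => // k.
    by apply: fd; rewrite ltnS.
  move=> /(congr1 (fun x => x ^+ N)%g); rewrite -!expgnA (mulnC d N) expgnA gN.
  by rewrite expg1n => /esym; apply: fj; rewrite !muln_gt0 d0 h0.
Qed.

End PhaseSequences.

(** * The Riesz construction *)

Section ContinuousFunctions.
Variables (R : realType) (X : topologicalType).
Implicit Types f g : X -> R.

Lemma continuous_maxr f g : continuous f -> continuous g ->
  continuous (fun x => Num.max (f x) (g x)).
Proof.
move=> cf cg x.
have -> : (fun x => Num.max (f x) (g x)) =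
    ((f \+ g) \+ (Num.norm \o (f \- g))) \* cst 2^-1.
  by apply/funext => y; rewrite /= maxr_absE.
have cfg : {for x, continuous (f \- g)} by exact: continuousB (cf x) (cg x).
apply: continuousM; last exact: cst_continuous.
apply: continuousD; first exact: continuousD (cf x) (cg x).
by apply: continuous_comp; [exact: cfg | exact: norm_continuous].
Qed.

Lemma compact_bigcup_sub (K : set X) (U : nat -> set X) : compact K ->
  (forall i, open (U i)) -> K `<=` \bigcup_i U i ->
  exists n, K `<=` \big[setU/set0]_(i < n) U i.
Proof.
move=> /compact_near_coveringP cK oU KU.
have [N _ NK] : \forall n \near \oo, K `<=` \big[setU/set0]_(i < n) U i.
  apply: cK => x Kx; have [i _ Uix] := KU x Kx.
  exists (U i, [set n | (i < n)%N]).
    by split; [exact: open_nbhs_nbhs (conj (oU i) Uix) | exists i.+1].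
  by move=> [y n] /= [Uiy ilt]; rewrite -bigcup_mkord; exists i.
by exists N; apply: NK; rewrite /= leqnn.
Qed.

Lemma continuous_bounded f : compact [set: X] -> continuous f ->
  exists2 M, 0 <= M & forall x, `|f x| <= M.
Proof.
move=> cX cf; have : compact (range f).
  by apply: continuous_compact => //; exact: continuous_subspaceT.
move=> /compact_bounded[M [_ /(_ (Num.max M 0 + 1))]].
rewrite (le_lt_trans (_ : M <= Num.max M 0))// ?ltrDl// ?le_max ?lexx//.
move=> /(_ isT) Mf; exists (Num.max M 0 + 1).
  by rewrite addr_ge0// le_max lexx orbT.
by move=> x; apply: Mf; exists x.
Qed.

End ContinuousFunctions.

Section PositiveFunctional.
Variables (R : realType) (X : ptopologicalType).
Hypothesis compactX : compact [set: X].
Hypothesis hausdorffX : hausdorff_space X.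

Record mean_functional (L : (X -> R) -> R) : Prop := MeanFunctional {
  meanD : forall f g, continuous f -> continuous g -> L (f \+ g) = L f + L g;
  le_mean : forall f g, continuous f -> continuous g ->
    (forall x, f x <= g x) -> L f <= L g;
  mean_cst : forall c, L (cst c) = c }.

Variable L : (X -> R) -> R.
Hypothesis LM : mean_functional L.

Implicit Types (U V : set X) (f g : X -> R) (e : R).

(** Vanishing off [U] takes the place of a compact support inside [U]. [truncate] restores such a
    support, the compact set where [e <= f], and lowers the mean by at most [e]. *)
Definition subordinate U : set (X -> R) :=
  [set f : X -> R | [/\ continuous f, forall x, 0 <= f x <= 1 & forall x, ~ U x -> f x = 0]].

Definition truncate f e : X -> R := fun x => Num.max (f x - e) 0.

Lemma truncate_subordinate U f e : 0 <= e -> subordinate U f ->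
  subordinate (U `&` [set x | e < f x]) (truncate f e).
Proof.
move=> e0 [cf f01 f0]; split.
- apply: continuous_maxr => [x|x]; last exact: cst_continuous.
  by apply: continuousB; [exact: cf | exact: cst_continuous].
- move=> x; have /andP[f0x f1x] := f01 x; rewrite /truncate le_max lexx orbT /=.
  by rewrite ge_max; apply/andP; split; lra.
- move=> x nUx; apply/max_idPr; rewrite subr_le0 leNgt; apply/negP => fx.
  apply: nUx; split=> //; apply: contrapT => /f0 fx0.
  by move: fx; rewrite fx0 ltNge e0.
Qed.

Lemma mean_truncate f e : continuous f -> L f - e <= L (truncate f e).
Proof.
move=> cf.
have ct : continuous (truncate f e).
  apply: continuous_maxr => [x|x]; last exact: cst_continuous.
  by apply: continuousB; [exact: cf | exact: cst_continuous].
have cc : continuous (cst e : X -> R) by exact: cst_continuous.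
rewrite lerBlDr -[X in _ <= _ + X](mean_cst LM) -(meanD LM)//.
apply: (le_mean LM) => //.
  by move=> x; apply: continuousD; [exact: ct | exact: cc].
by move=> x /=; rewrite /truncate -lerBlDr le_max lexx.
Qed.

Definition open_content U : \bar R := ereal_sup [set (L f)%:E | f in subordinate U].

Lemma subordinate_le U V : U `<=` V -> subordinate U `<=` subordinate V.
Proof. by move=> UV f [cf f01 f0]; split=> // x /(contra_not (@UV x))/f0. Qed.

Lemma le_content U V : U `<=` V -> (open_content U <= open_content V)%E.
Proof.
move=> /subordinate_le UV; apply: ge_ereal_sup => _ [f Uf <-].
by apply: ereal_sup_ubound; exists f => //; exact: UV.
Qed.

Lemma mean_le_content U f : subordinate U f -> ((L f)%:E <= open_content U)%E.
Proof. by move=> Uf; apply: ereal_sup_ubound; exists f. Qed.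

Lemma content_ge0 U : (0 <= open_content U)%E.
Proof.
have := @mean_le_content U (cst 0); rewrite (mean_cst LM); apply; split=> //.
  by move=> x; exact: cst_continuous.
by move=> x; rewrite lexx ler01.
Qed.

Lemma contentT : open_content setT = 1%E.
Proof.
have cc (c : R) : continuous (cst c : X -> R) by move=> x; exact: cst_continuous.
apply/eqP; rewrite eq_le; apply/andP; split.
  apply: ge_ereal_sup => _ [f [cf f01 _] <-]; rewrite lee_fin.
  rewrite -[leRHS](mean_cst LM); apply: (le_mean LM) => // x.
  by case/andP: (f01 x).
have := @mean_le_content setT (cst 1); rewrite (mean_cst LM); apply; split=> // x.
  by rewrite lexx ler01.
by move=> /(_ I).
Qed.

Lemma content_le1 U : (open_content U <= 1)%E.
Proof. by rewrite -contentT; exact: le_content. Qed.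

Lemma content_fin_num U : open_content U \is a fin_num.
Proof.
by rewrite ge0_fin_numE ?content_ge0// (le_lt_trans (content_le1 _)) ?ltry.
Qed.

Lemma content0 : open_content set0 = 0%E.
Proof.
apply/eqP; rewrite eq_le content_ge0 andbT; apply: ge_ereal_sup => _ [f [cf _ f0] <-].
rewrite (_ : f = cst 0) ?(mean_cst LM)//.
by apply/funext => x; exact: f0.
Qed.

Lemma closed_superlevel f e : continuous f -> closed [set x | e <= f x].
Proof.
move=> cf; exact: (@preimage_closed _ _ f [set y | e <= y]).
Qed.

Lemma compact_closed_sub (K : set X) : closed K -> compact K.
Proof. by move=> cK; exact: (subclosed_compact cK compactX). Qed.

Lemma urysohn_01 (A B : set X) : closed A -> closed B -> A `&` B = set0 ->
  exists f : X -> R, [/\ continuous f, forall x, 0 <= f x <= 1,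
    forall x, A x -> f x = 0 & forall x, B x -> f x = 1].
Proof.
move=> cA cB AB.
have /(@uniform_separatorP _ R)[f [cf f01 fA fB]] :=
  normal_uniform_separator (compact_normal hausdorffX compactX) cA cB AB.
exists f; split=> // x.
- by have /f01 : range f (f x) by []; rewrite /= in_itv.
- by move=> Ax; apply: fA; exists x.
- by move=> Bx; apply: fB; exists x.
Qed.

Lemma continuousMr f g : continuous f -> continuous g -> continuous (f \* g).
Proof. by move=> cf cg x; apply: continuousM; [exact: cf | exact: cg]. Qed.

(* The truncation of [f] at [e] is supported in the compact set [e <= f], over
   which a Urysohn function splits it between [U] and [V]. *)
Lemma content_setU U V : open U -> open V ->
  (open_content (U `|` V) <= open_content U + open_content V)%E.
Proof.
move=> oU oV; apply: ge_ereal_sup => _ [f Sf <-].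
apply/lee_addgt0Pr => e e0; have [cf f01 f0] := Sf.
pose K := [set x | e <= f x]; have cK : closed K by exact: closed_superlevel.
have cKU : closed (K `\` U) by rewrite setDE; apply: closedI => //; exact: open_closedC.
have cKV : closed (K `\` V) by rewrite setDE; apply: closedI => //; exact: open_closedC.
have KUV : (K `\` U) `&` (K `\` V) = set0.
  rewrite -subset0 => x [[Kx nU] [_ nV]].
  by move: Kx; rewrite /K /= f0 ?leNgt ?e0// => -[].
have [g [cg g01 gU gV]] := urysohn_01 cKU cKV KUV.
have [ct t01 t0] := truncate_subordinate (ltW e0) Sf.
pose h := fun x => 1 - g x.
have ch : continuous h.
  by move=> x; apply: continuousB; [exact: cst_continuous | exact: cg].
have tK x : ~ K x -> truncate f e x = 0.
  by move=> nK; apply: t0 => -[_ /ltW].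
have SU : subordinate U (truncate f e \* g).
  split; first exact: continuousMr.
    move=> x; have /andP[? ?] := t01 x; have /andP[? ?] := g01 x.
    by rewrite /= mulr_ge0//= mulr_ile1.
  move=> x nU /=; have [Kx|nKx] := pselect (K x); first by rewrite gU ?mulr0.
  by rewrite tK ?mul0r.
have SV : subordinate V (truncate f e \* h).
  split; first exact: continuousMr.
    move=> x; have /andP[? ?] := t01 x; have /andP[? ?] := g01 x.
    by rewrite /= mulr_ge0 ?mulr_ile1 /h //=; lra.
  move=> x nV /=; have [Kx|nKx] := pselect (K x); first by rewrite /h gV ?subrr ?mulr0.
  by rewrite tK ?mul0r.
have fE : truncate f e = (truncate f e \* g) \+ (truncate f e \* h).
  by apply/funext => x /=; rewrite /h -mulrDr addrC subrK mulr1.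
have := mean_truncate e cf; rewrite fE (meanD LM); [|exact: continuousMr..].
rewrite -lee_fin EFinB EFinD leeBlDr// => /le_trans; apply.
by apply: leeD => //; apply: leeD; exact: mean_le_content.
Qed.

Lemma content_bigsetU (U : nat -> set X) n : (forall i, open (U i)) ->
  (open_content (\big[setU/set0]_(i < n) U i) <= \sum_(i < n) open_content (U i))%E.
Proof.
move=> oU; elim: n => [|n IH]; first by rewrite !big_ord0 content0.
rewrite !big_ord_recr /=; apply: (le_trans (content_setU _ _)) => //.
  by rewrite -bigcup_mkord; exact: bigcup_open.
exact: leeD2r.
Qed.

(** The set [e <= f] is compact, so finitely many [U i] cover it and the truncation of [f] is
    subordinate to their union. *)
Lemma content_bigcup (U : nat -> set X) : (forall i, open (U i)) ->
  (open_content (\bigcup_i U i) <= \sum_(i <oo) open_content (U i))%E.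
Proof.
move=> oU; apply: ge_ereal_sup => _ [f Sf <-].
apply/lee_addgt0Pr => e e0; have [cf f01 f0] := Sf.
have cK := compact_closed_sub (@closed_superlevel f e cf).
have [|n Kn] := compact_bigcup_sub cK oU.
  move=> x /= ex; apply: contrapT => /f0 fx0.
  by move: ex; rewrite fx0 leNgt e0.
have Sn : subordinate (\big[setU/set0]_(i < n) U i) (truncate f e).
  apply: subordinate_le (truncate_subordinate (ltW e0) Sf) => x [_ /ltW].
  exact: Kn.
have := mean_truncate e cf; rewrite -lee_fin EFinB leeBlDr// => /le_trans; apply.
rewrite leeD2r//; apply: (le_trans (mean_le_content Sn)).
apply: (le_trans (content_bigsetU n oU)).
rewrite -(big_mkord xpredT (fun i => open_content (U i))).
by apply: nneseries_lim_ge => i _ _; exact: content_ge0.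
Qed.

Definition radon (A : set X) : \bar R :=
  ereal_inf [set open_content U | U in [set U | open U /\ A `<=` U]].

Lemma radon_open U : open U -> radon U = open_content U.
Proof.
move=> oU; apply/eqP; rewrite eq_le; apply/andP; split.
  by apply: ereal_inf_lbound; exists U => //; split=> //.
by apply: le_ereal_inf_tmp => _ [V [oV UV] <-]; exact: le_content.
Qed.

Lemma radon_ge0 (A : set X) : (0 <= radon A)%E.
Proof. by apply: le_ereal_inf_tmp => _ [V [oV UV] <-]; exact: content_ge0. Qed.

Lemma le_radon : {homo radon : A B / A `<=` B >-> (A <= B)%E}.
Proof.
move=> A B AB; apply: le_ereal_inf_tmp => _ [V [oV BV] <-].
by apply: ereal_inf_lbound; exists V => //; split=> //; exact: subset_trans BV.
Qed.

Lemma radon0 : radon set0 = 0%E.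
Proof. by rewrite radon_open ?content0//; exact: open0. Qed.

Lemma radonT : radon setT = 1%E.
Proof. by rewrite radon_open ?contentT//; exact: openT. Qed.

Lemma radon_fin_num (A : set X) : radon A \is a fin_num.
Proof.
rewrite ge0_fin_numE ?radon_ge0// (@le_lt_trans _ _ 1%E) ?ltry//.
by rewrite -radonT; exact: le_radon.
Qed.

Lemma radon_adherent (A : set X) e : 0 < e ->
  exists U, [/\ open U, A `<=` U & (open_content U <= radon A + e%:E)%E].
Proof.
move=> e0; have [_ [U [oU AU] <-] /ltW] := lb_ereal_inf_adherent e0 (radon_fin_num A).
by exists U.
Qed.

Lemma radon_sigma_subadditive : sigma_subadditive radon.
Proof.
move=> A; apply/lee_addgt0Pr => e e0.
apply: le_trans (epsilon_trick _ _ (ltW e0)); last by move=> n; exact: radon_ge0.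
have /choice[U PU] n := @radon_adherent (A n) (e / (2 ^ n.+1)%:R)
  (ltac:(by rewrite divr_gt0// ltr0n expn_gt0)).
apply: (@le_trans _ _ (open_content (\bigcup_n U n))).
  apply: ereal_inf_lbound; exists (\bigcup_n U n) => //; split.
    by apply: bigcup_open => n _; have [] := PU n.
  by apply: subset_bigcup => n _; have [] := PU n.
apply: (le_trans (content_bigcup _)) => [n|]; first by have [] := PU n.
by apply: lee_nneseries => n _; [move=> _; exact: content_ge0 | have [] := PU n].
Qed.

Definition radon_outer_measure : {outer_measure set X -> \bar R} :=
  HB.pack radon (isOuterMeasure.Build R X radon
    radon0 radon_ge0 le_radon radon_sigma_subadditive).

(** Take [V] nearly optimal over [A], [f] nearly optimal for the part of [V] in [U], and then [g]
    nearly optimal for [V] minus the set [K] where [f >= e / 4]. The truncation of [f] lives on [K]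
    and [g] off [K], so their sum is still bounded by 1 and competes for the content of [V]. *)
Lemma radon_open_caratheodory U : open U -> radon.-caratheodory U.
Proof.
move=> oU; apply: (@le_caratheodory_measurable _ _ radon_outer_measure) => A /=.
apply/lee_addgt0Pr => e e0.
(* Four losses add up to [e]: the choices of [V], [f] and [g], and the truncation. *)
have e40 : 0 < e / 4 by lra.
have [V [oV AV VA]] := radon_adherent A e40.
have oVU : open (V `&` U) by exact: openI.
have [_ [f Sf <-] ff] := ub_ereal_sup_adherent e40 (content_fin_num (V `&` U)).
rewrite -/(open_content _) in ff.
have [cf f01 f0] := Sf.
pose K := [set x | e / 4 <= f x].
have cK : closed K by exact: closed_superlevel.
have oVK : open (V `\` K) by rewrite setDE; apply: openI => //; exact: closed_openC.
have [_ [g Sg <-] gg] := ub_ereal_sup_adherent e40 (content_fin_num (V `\` K)).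
rewrite -/(open_content _) in gg.
have [cg g01 g0] := Sg.
have AU : (radon (A `&` U) <= open_content (V `&` U))%E.
  by apply: ereal_inf_lbound; exists (V `&` U) => //; split=> //; exact: setSI.
have AnU : (radon (A `&` ~` U) <= open_content (V `\` K))%E.
  apply: ereal_inf_lbound; exists (V `\` K) => //; split=> // x [Ax nUx].
  split; first exact: AV.
  rewrite /K /= => fx; have : f x = 0 by apply: f0 => -[].
  by move=> fx0; move: fx; rewrite fx0 leNgt e40.
have [ct t01 t0] := truncate_subordinate (ltW e40) Sf.
have SV : subordinate V (truncate f (e / 4) \+ g).
  split; first by move=> x; apply: continuousD; [exact: ct | exact: cg].
    move=> x /=; have [Kx|nKx] := pselect (K x).
      by rewrite g0 ?addr0// => -[].
    by rewrite t0 ?add0r// => -[_ /ltW].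
  move=> x nVx /=; rewrite t0 ?g0 ?addr0//; first by move=> -[].
  by move=> -[[]].
have := mean_le_content SV; rewrite (meanD LM)//.
have := mean_truncate (e / 4) cf.
move: VA AU AnU ff gg.
rewrite -(fineK (radon_fin_num A)) -(fineK (radon_fin_num (A `&` U))).
rewrite -(fineK (radon_fin_num (A `&` ~` U))) -(fineK (content_fin_num V)).
rewrite -(fineK (content_fin_num (V `&` U))) -(fineK (content_fin_num (V `\` K))).
rewrite -!(EFinD, EFinN) !(lee_fin, lte_fin).
by lra.
Qed.

End PositiveFunctional.

(** * The Borel probability of a mean functional: invariance, regularity and uniqueness *)

Section RadonMeasure.
Variables (R : realType) (X : ptopologicalType).
Hypothesis compactX : compact [set: X].
Hypothesis hausdorffX : hausdorff_space X.
Variable L : (X -> R) -> R.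
Hypothesis LM : mean_functional L.

Lemma radon_sigma_additive :
  semi_sigma_additive (radon L : set (borelType X) -> \bar R).
Proof.
have sub : (measurable : set (set (borelType X))) `<=` (radon L).-caratheodory.
  apply: smallest_sub; last exact: radon_open_caratheodory.
  exact: (@sigma_algebra_measurable _
    (caratheodory_type (radon_outer_measure compactX hausdorffX LM))).
move=> A mA tA mA'.
apply: (@caratheodory_measure_sigma_additive _ _
  (radon_outer_measure compactX hausdorffX LM)) => //.
  by move=> i; apply: sub; exact: mA.
exact: sub.
Qed.

Lemma radon_measure_exists :
  exists mu : probability (borelType X) R, forall B, mu B = radon L B.
Proof.
pose m := isMeasure.Build _ (borelType X) R (radon L : set (borelType X) -> _)
  (radon0 LM) (radon_ge0 LM) radon_sigma_additive.
pose mu : {measure set (borelType X) -> \bar R} := HB.pack (radon L : set (borelType X) -> _) m.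
pose p := Measure_isProbability.Build _ (borelType X) R mu (radonT LM).
pose P : probability (borelType X) R := HB.pack (radon L : set (borelType X) -> _) m p.
by exists P.
Qed.

Lemma le_content_preimage (t : X -> X) (U : set X) : continuous t ->
  (forall f, continuous f -> L (f \o t) = L f) ->
  (open_content L U <= open_content L (t @^-1` U))%E.
Proof.
move=> ct Lt; apply: ge_ereal_sup => _ [f [cf f01 f0] <-].
rewrite -Lt//; apply: mean_le_content; split.
- by move=> x; apply: continuous_comp; [exact: ct | exact: cf].
- by move=> x; exact: f01.
- by move=> x nx /=; exact: f0.
Qed.

Lemma le_radon_preimage (t t' : X -> X) (A : set X) :
  continuous t -> continuous t' -> cancel t t' -> cancel t' t ->
  (forall f, continuous f -> L (f \o t) = L f) ->
  (radon L (t @^-1` A) <= radon L A)%E.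
Proof.
move=> ct ct' tK t'K Lt; apply: le_ereal_inf_tmp => _ [U [oU AU] <-].
apply: ge_ereal_inf; exists (open_content L (t @^-1` U)).
  exists (t @^-1` U) => //; split; last by move=> x; exact: AU.
  by apply: open_comp => // x _; exact: ct.
have -> : U = t' @^-1` (t @^-1` U) by apply/funext => x /=; rewrite t'K.
rewrite [X in (open_content _ X <= _)%E](_ : _ = t @^-1` U); last first.
  by apply/funext => x /=; rewrite !tK.
(* Invariance of [L] under the inverse [t'] is its invariance under [t], applied to [f \o t']. *)
apply: le_content_preimage => // f cf; rewrite -Lt.
  by congr L; apply/funext => x /=; rewrite tK.
by move=> x; apply: continuous_comp; [exact: ct' | exact: cf].
Qed.

Lemma radon_preimage (t t' : X -> X) (A : set X) :
  continuous t -> continuous t' -> cancel t t' -> cancel t' t ->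
  (forall f, continuous f -> L (f \o t) = L f) ->
  radon L (t @^-1` A) = radon L A.
Proof.
move=> ct ct' tK t'K Lt; apply/eqP; rewrite eq_le; apply/andP; split.
  exact: (@le_radon_preimage t t').
have {1}-> : A = t' @^-1` (t @^-1` A) by apply/funext => x /=; rewrite t'K.
apply: (@le_radon_preimage t' t) => // f cf; rewrite -Lt.
  by congr L; apply/funext => x /=; rewrite tK.
by move=> x; apply: continuous_comp; [exact: ct' | exact: cf].
Qed.

Lemma measurable_open (U : set X) : open U -> measurable (U : set (borelType X)).
Proof. by move=> oU; exact: sub_sigma_algebra. Qed.

Lemma measurable_closed (K : set X) : closed K -> measurable (K : set (borelType X)).
Proof.
by move=> /closed_openC/measurable_open/measurableC; rewrite setCK.
Qed.

(** Outer regularity is built into [radon]. Inner regularity is outer regularity of the complement: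
    in a compact space the complement of an open set is compact. *)
Lemma radon_regular (mu : probability (borelType X) R) :
  (forall B, mu B = radon L B) -> regular_measure mu.
Proof.
move=> muE.
have outer (B : set X) :
    mu B = ereal_inf [set mu U | U in [set U : set X | open U /\ B `<=` U]].
  rewrite muE /radon; congr ereal_inf; apply/seteqP; split=> _ [U [oU BU] <-];
    by exists U => //; rewrite muE radon_open.
move=> B mB; split; first exact: outer.
apply/eqP; rewrite eq_le; apply/andP; split; last first.
  apply: ge_ereal_sup => _ [K [cK KB] <-]; apply: le_measure; rewrite ?inE//.
  by apply: measurable_closed; exact: compact_closed.
apply/lee_addgt0Pr => e e0.
have [U [oU BU Ue]] := radon_adherent LM (~` B) e0.
rewrite -leeBlDr//; apply: le_ereal_sup_tmp; exists (mu (~` U)).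
  exists (~` U) => //; split; last by move=> x nUx; apply: contrapT => /BU.
  by apply: (compact_closed_sub compactX); exact: open_closedC.
have mU := measurable_open oU.
move: Ue; rewrite probability_setC// -radon_open// -!muE.
rewrite (probability_setC mu mB).
rewrite -(fineK (fin_num_measure mu _ mB)) -(fineK (fin_num_measure mu _ mU)).
by rewrite -!(EFinD, EFinN) -?EFinB !lee_fin; lra.
Qed.

Lemma continuous_measurable (f : X -> R) : continuous f ->
  measurable_fun [set: borelType X] f.
Proof.
move=> cf; apply: (measurability _ (measurable_realfun.RGenOInfty.measurableE R)).
move=> _ [_ [x ->] <-]; rewrite setTI; apply: measurable_open.
apply: open_comp => [y _|]; [exact: cf | exact: interval_open].
Qed.

Lemma continuous_emeasurable (f : X -> R) : continuous f ->
  measurable_fun [set: borelType X] (EFin \o (f : borelType X -> R)).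
Proof. by move=> cf; apply/measurable_EFinP; exact: continuous_measurable. Qed.

(** On an open [U], inner regularity reduces one inequality to compact [K] inside [U], where a
    Urysohn function lies between the two indicators; the other holds because subordinate functions
    lie below the indicator of [U]. Outer regularity then passes to all Borel sets. *)
Lemma regular_probability_unique (nu : probability (borelType X) R) :
  regular_measure nu ->
  (forall f : X -> R, continuous f -> (\int[nu]_x (f x)%:E)%E = (L f)%:E) ->
  forall B, measurable B -> nu B = radon L B.
Proof.
move=> rnu nuL.
have nuU U : open U -> nu U = open_content L U.
  move=> oU; have mU := measurable_open oU.
  apply/eqP; rewrite eq_le; apply/andP; split.
    rewrite (rnu _ mU).2; apply: ge_ereal_sup => _ [K [cK KU] <-].
    have clK : closed K by exact: compact_closed.
    have mK := measurable_closed clK.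
    have [f [cf f01 f0 f1]] : exists f : X -> R, [/\ continuous f,
        forall x, 0 <= f x <= 1, forall x, (~` U) x -> f x = 0 &
        forall x, K x -> f x = 1].
      apply: urysohn_01 => //; first exact: open_closedC.
      by rewrite -subset0 => x [nUx /KU].
    have mf := continuous_emeasurable cf.
    apply: (@le_trans _ _ (L f)%:E); last exact: mean_le_content.
    have -> : nu K = nu (K `&` setT) by rewrite setIT.
    rewrite -nuL// -integral_indic//.
    apply: ge0_le_integral => //.
    - by apply/measurable_EFinP; exact: measurable_indic.
    - move=> x _; rewrite lee_fin indicE; have [|_] := boolP (x \in K).
        by rewrite inE => /f1 ->.
      by case/andP: (f01 x).
  apply: ge_ereal_sup => _ [f [cf f01 f0] <-].
  have mf := continuous_emeasurable cf.
  have -> : nu U = nu (U `&` setT) by rewrite setIT.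
    rewrite -nuL// -integral_indic//.
  apply: ge0_le_integral => //.
  - by move=> x _; rewrite lee_fin; case/andP: (f01 x).
  - by apply/measurable_EFinP; exact: measurable_indic.
  - move=> x _; rewrite lee_fin indicE; have [_|] := boolP (x \in U).
      by case/andP: (f01 x).
    by rewrite notin_setE => /f0 ->.
move=> B mB; rewrite (rnu _ mB).1 /radon; congr ereal_inf.
by apply/seteqP; split=> _ [U [oU BU] <-]; exists U; rewrite ?nuU.
Qed.

End RadonMeasure.

(** * Birkhoff means and unique ergodicity *)

Section BirkhoffMeans.
Variables (R : realType) (X : Type) (s : X -> X).
Implicit Types (f g : X -> R) (x : X) (c e : R).

Definition birkhoff_sum f x N : R := \sum_(n < N) f (iter n s x).

Definition mean_within f x c e : Prop := exists N0, forall N, (N0 <= N)%N ->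
  `|birkhoff_sum f x N - c * N%:R| <= e * N%:R.

Definition birkhoff_mean f c : Prop := forall x e, 0 < e -> mean_within f x c e.

(** The constant may depend on [e] but not on the point. In this form the property survives uniform
    approximation of [f] without a limit having to be named. *)
Definition has_approx_mean f : Prop :=
  forall e, 0 < e -> exists c, forall x, mean_within f x c e.

Lemma mean_within_le f g x c d e e' : (forall x, f x <= g x) ->
  mean_within f x c e -> mean_within g x d e' -> c <= d + e + e'.
Proof.
move=> fg [N1 h1] [N2 h2]; pose N := (maxn N1 N2).+1.
have := h1 N (leq_trans (leq_maxl _ _) (leqnSn _)).
have := h2 N (leq_trans (leq_maxr _ _) (leqnSn _)).
have : birkhoff_sum f x N <= birkhoff_sum g x N by apply: ler_sum.
have N0 : 0 < N%:R :> R by rewrite ltr0n.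
rewrite !ler_norml => a /andP[_ b] /andP[d' _]; rewrite -(ler_pM2r N0).
by nra.
Qed.

Lemma birkhoff_mean_le f g c d (x : X) : (forall x, f x <= g x) ->
  birkhoff_mean f c -> birkhoff_mean g d -> c <= d.
Proof.
move=> fg fc gd; apply/ler_addgt0Pr => e e0.
have e20 : 0 < e / 2 by lra.
by have := mean_within_le fg (fc x _ e20) (gd x _ e20); lra.
Qed.

Lemma birkhoff_mean_unique f c d (x : X) :
  birkhoff_mean f c -> birkhoff_mean f d -> c = d.
Proof.
by move=> fc fd; apply/eqP; rewrite eq_le !(@birkhoff_mean_le f f _ _ x).
Qed.

Lemma birkhoff_meanD f g c d : birkhoff_mean f c -> birkhoff_mean g d ->
  birkhoff_mean (f \+ g) (c + d).
Proof.
move=> fc gd x e e0; have e20 : 0 < e / 2 by lra.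
have [N1 h1] := fc x _ e20; have [N2 h2] := gd x _ e20.
exists (maxn N1 N2) => N; rewrite geq_max => /andP[/h1 {}h1 /h2 {}h2].
rewrite /birkhoff_sum big_split /= mulrDl opprD addrACA.
by apply: (le_trans (ler_normD _ _)); apply: (le_trans (lerD h1 h2)); lra.
Qed.

Lemma birkhoff_mean_cst c : birkhoff_mean (cst c) c.
Proof.
move=> x e e0; exists 0%N => N _.
by rewrite /birkhoff_sum sumr_const card_ord mulr_natr subrr normr0 mulr_ge0// ltW.
Qed.

Lemma birkhoff_mean_comp f c : birkhoff_mean f c -> birkhoff_mean (f \o s) c.
Proof.
move=> fc x e /(fc (s x))[N0 h]; exists N0 => N /h.
by rewrite /birkhoff_sum; under eq_bigr do rewrite -iterSr iterS.
Qed.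

(** Any two admissible intervals from [c - e] to [c + e] meet, as comparison at one point shows; so
    the supremum of the lower ends lies in all of them. *)
Lemma approx_mean_limit f (x : X) : has_approx_mean f ->
  exists c, birkhoff_mean f c.
Proof.
move=> fM.
pose A := [set r | exists c e, [/\ 0 < e, forall x, mean_within f x c e & r = c - e]].
have Aub c e : 0 < e -> (forall x, mean_within f x c e) -> ubound A (c + e).
  move=> e0 h _ [c' [e' [e'0 h' ->]]].
  by have := mean_within_le (fun=> lexx _) (h' x) (h x); lra.
have [c1 h1] := fM 1 ltr01.
have A0 : A !=set0 by exists (c1 - 1), c1, 1.
have Asup : has_sup A by split=> //; exists (c1 + 1); exact: Aub.
exists (sup A) => y e e0; have e20 : 0 < e / 2 by lra.
have [c h] := fM _ e20.
have cl : c - e / 2 <= sup A by apply: ub_le_sup; [case: Asup | exists c, (e / 2)].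
have cu : sup A <= c + e / 2 by apply: ge_sup => //; exact: Aub.
have [N0 hN] := h y; exists N0 => N /hN.
have N00 : 0 <= N%:R :> R by [].
by rewrite !ler_norml => /andP[a b]; apply/andP; split; nra.
Qed.

End BirkhoffMeans.

Section UniqueErgodicity.
Variables (R : realType) (X : ptopologicalType) (t : X -> X).
Hypothesis tX : dynamical_system t.
Hypothesis tM : forall f : X -> R, continuous f -> has_approx_mean t f.

Let compactX : compact [set: X]. Proof. by case: tX. Qed.
Let hausdorffX : hausdorff_space X. Proof. by case: tX. Qed.
Let ct : continuous t. Proof. by case: tX => _ _ []. Qed.

Definition space_mean (f : X -> R) : R := xget 0 [set c | birkhoff_mean t f c].

Lemma space_meanP f : continuous f -> birkhoff_mean t f (space_mean f).
Proof.
move=> /tM/(approx_mean_limit point)[c fc].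
by apply: (@xgetPex _ 0 [set c | birkhoff_mean t f c]); exists c.
Qed.

Lemma space_mean_functional : mean_functional space_mean.
Proof.
split=> [f g cf cg|f g cf cg fg|c].
- apply: (birkhoff_mean_unique point); last first.
    by apply: birkhoff_meanD; exact: space_meanP.
  apply: space_meanP => x; exact: continuousD (cf x) (cg x).
- apply: (birkhoff_mean_le point fg); exact: space_meanP.
- apply: (birkhoff_mean_unique point); last exact: birkhoff_mean_cst.
  by apply: space_meanP => x; exact: cst_continuous.
Qed.

Lemma space_mean_comp f : continuous f -> space_mean (f \o t) = space_mean f.
Proof.
move=> cf; apply: (birkhoff_mean_unique point).
  by apply: space_meanP => x; apply: continuous_comp; [exact: ct | exact: cf].
by apply: birkhoff_mean_comp; exact: space_meanP.
Qed.

(** * Integrals against an arbitrary invariant probability *)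

Section InvariantIntegral.
Variable nu : probability (borelType X) R.
Hypothesis nuI : invariant_measure t nu.
Implicit Types f g : X -> R.

Lemma continuous_integrable f : continuous f ->
  nu.-integrable [set: borelType X] (EFin \o (f : borelType X -> R)).
Proof.
move=> cf; apply: measurable_bounded_integrable => //.
- by apply: (le_lt_trans (probability_le1 nu measurableT)); exact: ltry.
- exact: continuous_measurable.
- have [B _ fB] := continuous_bounded compactX cf.
  exists B; split=> [|M BM x _ /=]; first by rewrite num_real.
  exact: le_trans (fB x) (ltW BM).
Qed.

Lemma continuous_measurable_map :
  measurable_fun [set: borelType X] (t : borelType X -> borelType X).
Proof.
apply: (@measurability _ _ (borelType X) (borelType X) setT t (@open X) erefl).
move=> _ [U oU <-]; rewrite setTI.
by apply: measurable_open; apply: open_comp => // x _; exact: ct.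
Qed.

Let J f : R := (\int[nu]_x (f : borelType X -> R) x)%R.

Lemma integral_comp_invariant f : continuous f -> J (f \o t) = J f.
Proof.
move=> cf; rewrite /J /Rintegral; congr fine.
have cft : continuous (f \o t).
  by move=> x; apply: continuous_comp; [exact: ct | exact: cf].
have mt := continuous_measurable_map.
have := integral_pushforward mt (continuous_emeasurable cf)
  (continuous_integrable cft) (@measurableT _ (borelType X)).
rewrite preimage_setT => <-.
by apply: eq_measure_integral => A mA _; exact: nuI.
Qed.

Lemma continuous_birkhoff_sum f N : continuous f ->
  continuous (birkhoff_sum t f ^~ N).
Proof.
move=> cf; rewrite /birkhoff_sum; elim: N => [|N IH] x.
  under [X in continuous_at _ X]funext do rewrite big_ord0.
  exact: cst_continuous.
under [X in continuous_at _ X]funext do rewrite big_ord_recr.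
apply: continuousD; first exact: IH.
apply: (@continuous_comp _ _ _ (iter N t) f); last exact: cf.
by elim: N {IH} x => [x|N IH x]; [exact: cvg_id | apply: continuous_comp; [exact: IH | exact: ct]].
Qed.

Lemma continuous_iter N : continuous (iter N t).
Proof.
elim: N => [|N IH] x; first exact: cvg_id.
by apply: (@continuous_comp _ _ _ (iter N t) t); [exact: IH | exact: ct].
Qed.

Lemma integral_comp_iter f N : continuous f -> J (f \o iter N t) = J f.
Proof.
move=> cf; elim: N => [//|N IH].
rewrite -[RHS]IH -[RHS]integral_comp_invariant.
  by congr J; apply/funext => x /=; rewrite -iterS iterSr.
by move=> x; apply: continuous_comp; [exact: continuous_iter | exact: cf].
Qed.

Lemma integral_birkhoff_sum f N : continuous f -> J (birkhoff_sum t f ^~ N) = N%:R * J f.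
Proof.
move=> cf; elim: N => [|N IH].
  rewrite mul0r /J (_ : birkhoff_sum _ _ ^~ _ = cst 0).
    by rewrite Rintegral_cst// mul0r.
  by apply/funext => x; rewrite /birkhoff_sum big_ord0.
have cfN : continuous (f \o iter N t).
  by move=> x; apply: continuous_comp; [exact: continuous_iter | exact: cf].
rewrite -natr1 mulrDl mul1r -IH -(integral_comp_iter N cf) /J.
rewrite -RintegralD//; last 2 first.
- by apply: continuous_integrable; exact: continuous_birkhoff_sum.
- exact: continuous_integrable.
by congr Rintegral; apply/funext => x; rewrite /birkhoff_sum big_ord_recr.
Qed.

Lemma integral_space_mean f : continuous f ->
  (\int[nu]_x (f x)%:E)%E = (space_mean f)%:E.
Proof.
move=> cf; have [B _ fB] := continuous_bounded compactX cf.
(* The index [n.+1] avoids dividing by 0. *)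
pose F n (x : borelType X) := (birkhoff_sum t f x n.+1 / n.+1%:R)%:E.
have intJ g : continuous g -> (\int[nu]_x (g x)%:E)%E = (J g)%:E.
  move=> cg; rewrite /J /Rintegral fineK//.
  exact: (integrable_fin_num measurableT (continuous_integrable cg)).
have n0 n : n.+1%:R != 0 :> R by rewrite pnatr_eq0.
have cF n : continuous (fun x => birkhoff_sum t f x n.+1 / n.+1%:R).
  apply: (@continuousMr _ _ (birkhoff_sum t f ^~ n.+1) (cst n.+1%:R^-1)).
    exact: continuous_birkhoff_sum.
  by move=> x; exact: cst_continuous.
have intF n : (\int[nu]_x F n x)%E = (J f)%:E.
  rewrite /F (intJ _ (cF n)); congr EFin.
  rewrite /J; under eq_Rintegral do rewrite mulrC.
  rewrite RintegralZl//; last first.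
    by apply: continuous_integrable; exact: continuous_birkhoff_sum.
  by rewrite -[X in _ * X]/(J _) integral_birkhoff_sum// mulKf.
have [] := @dominated_convergence _ (borelType X) R nu setT measurableT F
  (cst (space_mean f)%:E) (cst B%:E).
- move=> n; exact: (continuous_emeasurable (cF n)).
- exact: measurable_cst.
- apply: aeW => x _; apply: cvg_EFin; first by near=> n.
  apply/cvgrPdist_le => e e0 /=.
  have [N0 hN] := space_meanP cf x e0.
  exists N0 => // n /= Nn; rewrite distrC.
  have := hN n.+1 (leqW Nn).
  have -> : birkhoff_sum t f x n.+1 - space_mean f * n.+1%:R =
     (birkhoff_sum t f x n.+1 / n.+1%:R - space_mean f) * n.+1%:R.
    by rewrite mulrBl divfK.
  by rewrite normrM normr_nat ler_pM2r// ltr0n.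
- by apply: continuous_integrable => x; exact: cst_continuous.
- apply: aeW => x n _; rewrite lee_fin normrM normfV normr_nat.
  rewrite ler_pdivrMr ?ltr0n// (le_trans (ler_norm_sum _ _ _))//.
  apply: (@le_trans _ _ (\sum_(k < n.+1) B)); first exact: ler_sum.
  by rewrite sumr_const card_ord mulr_natr.
move=> _ _; rewrite integral_cst//. rewrite [X in (_ * X)%E](probability_setT nu) mule1.
under [X in X @ _ --> _]eq_fun do rewrite intF.
rewrite intJ// => Jlim.
by apply: (cvg_unique (@ereal_hausdorff R) _ Jlim); exact: cvg_cst.
Unshelve. all: by end_near. Qed.

End InvariantIntegral.

Lemma mean_uniquely_ergodic : uniquely_ergodic R t.
Proof.
have LM := space_mean_functional.
have [mu muE] := radon_measure_exists compactX hausdorffX LM.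
have [_ _ [_ [t' [ct' tK t'K]]]] := tX.
exists mu; split.
- exact: (radon_regular compactX hausdorffX LM).
- move=> B _; rewrite !muE; apply: (radon_preimage _ ct ct' tK t'K).
  exact: space_mean_comp.
- move=> nu rnu inu B mB; rewrite muE.
  apply: regular_probability_unique => // f cf; exact: integral_space_mean.
Qed.

End UniqueErgodicity.

(** * The Stone-Weierstrass theorem *)

(** The upper sets of members of [D] generate a filter on [I], and compactness in its near-covering
    form yields one index valid at all points. Stone-Weierstrass uses it in place of finite
    subcovers with finite maxima or minima. *)
Lemma compact_directed_cover (X : topologicalType) (I : Type)
    (D : set I) (le : I -> I -> Prop) (P : I -> X -> Prop) :
  compact [set: X] -> D !=set0 -> (forall i, le i i) ->
  (forall i j, D i -> D j ->
     exists k, [/\ D k, forall l, le k l -> le i l & forall l, le k l -> le j l]) ->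
  (forall i j x, le i j -> P i x -> P j x) ->
  (forall x : X, exists2 i, D i & \forall y \near x, P i y) ->
  exists2 i, D i & forall x, P i x.
Proof.
move=> /compact_near_coveringP cX [i0 Di0] lexx ledir leP cov.
pose F := filter_from D (fun i => [set j | le i j]).
have FF : Filter F.
  apply: filter_from_filter; first by exists i0.
  move=> i j Di Dj; have [k [Dk ki kj]] := ledir i j Di Dj.
  by exists k => // l kl; split; [exact: ki | exact: kj].
have [x _|i Di Pi] := cX I F P FF; last first.
  by exists i => // x; apply: Pi => //; exact: lexx.
have [i Di Px] := cov x.
exists ([set y | P i y], [set j | le i j]); first by split=> //; exists i.
by move=> [y j] /= [Piy ij]; exact: leP Piy.
Qed.

(* The iterates of q |-> q + (t^2 - q^2) / 2 from 0 are polynomials in t that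
   converge to |t| on [-1, 1]. *)
Fixpoint abs_approx (R : realType) (t : R) (n : nat) : R :=
  if n is m.+1 then abs_approx t m + (t ^+ 2 - abs_approx t m ^+ 2) / 2 else 0.

(** The error [r = a - q] becomes [r * (1 - (a + q) / 2)], which is at most [r * (1 - r / 2)]; a
    bound of order [2 / n] persists under this map. *)
Lemma abs_approxP (R : realType) (t : R) n : `|t| <= 1 ->
  0 <= abs_approx t n <= `|t| /\ `|t| - abs_approx t n <= 2 / n.+1%:R.
Proof.
move=> t1; have t0 : 0 <= `|t| by [].
have tt : t ^+ 2 = `|t| ^+ 2 by rewrite real_normK// num_real.
elim: n => [|n [/andP[q0 qt] qn]] /=.
  by rewrite lexx t0 divr1 subr0; split=> //; lra.
rewrite tt; set q := abs_approx t n in q0 qt qn *; set a := `|t| in t0 t1 q0 qt qn *.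
have bounds : 0 <= q + (a ^+ 2 - q ^+ 2) / 2 <= a.
  by apply/andP; split; nra.
split=> //.
have -> : a - (q + (a ^+ 2 - q ^+ 2) / 2) = (a - q) * (1 - (a + q) / 2) by field.
have n1 : 0 < n.+1%:R :> R by rewrite ltr0n.
have n2 : 0 < n.+2%:R :> R by rewrite ltr0n.
rewrite ler_pdivlMr//; rewrite ler_pdivlMr// in qn.
have -> : n.+2%:R = n.+1%:R + 1 :> R by rewrite -natr1.
have n11 : 1 <= n.+1%:R :> R by rewrite ler1n.
move: (n.+1%:R) n1 n11 qn => N n1 n11 qn.
set r := a - q in qn *; have r0 : 0 <= r by rewrite /r; lra.
have r1 : r <= 1 by rewrite /r; lra.
apply: (@le_trans _ _ (r * (1 - r / 2) * (N + 1))).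
  by rewrite ler_wpM2r//; [lra | rewrite ler_wpM2l// /r; lra].
(* In the second case [1 - r / 2 < N / (N + 1)], so the product is below [r * N <= 2]. *)
have [rN|rN] := leP (r * (N + 1)) 2; first by nra.
by nra.
Qed.

Section StoneWeierstrass.
Variables (R : realType) (X : topologicalType).
Hypothesis compactX : compact [set: X].
Variable A : set (X -> R).
Hypothesis A_continuous : forall f, A f -> continuous f.
Hypothesis A_cst : forall c, A (cst c).
Hypothesis AD : forall f g, A f -> A g -> A (f \+ g).
Hypothesis AM : forall f g, A f -> A g -> A (f \* g).
Hypothesis A_separates : forall x y, x <> y -> exists2 f, A f & f x <> f y.
Implicit Types f g : X -> R.

Definition uniform_closure : set (X -> R) := [set f | continuous f /\
  forall e : R, 0 < e -> exists2 g, A g & forall x, `|f x - g x| <= e].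
Local Notation B := uniform_closure.

Lemma subset_uniform_closure : A `<=` B.
Proof.
move=> f Af; split; first exact: A_continuous.
by move=> e e0; exists f => // x; rewrite subrr normr0 ltW.
Qed.

Lemma uniform_closureK f : continuous f ->
  (forall e, 0 < e -> exists2 g, B g & forall x, `|f x - g x| <= e) -> B f.
Proof.
move=> cf fB; split=> // e e0; have e20 : 0 < e / 2 by lra.
have [g [cg gA] fg] := fB _ e20; have [h Ah gh] := gA _ e20.
exists h => // x; apply: (le_trans (ler_distD (g x) _ _)).
by have := fg x; have := gh x; lra.
Qed.

Lemma uniform_closureD f g : B f -> B g -> B (f \+ g).
Proof.
move=> [cf fA] [cg gA]; split.
  by move=> x; exact: continuousD (cf x) (cg x).
move=> e e0; have e20 : 0 < e / 2 by lra.
have [f' Af' ff'] := fA _ e20; have [g' Ag' gg'] := gA _ e20.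
exists (f' \+ g'); first exact: AD.
move=> x /=; rewrite opprD addrACA; apply: (le_trans (ler_normD _ _)).
by have := ff' x; have := gg' x; lra.
Qed.

Lemma uniform_closureM f g : B f -> B g -> B (f \* g).
Proof.
move=> [cf fA] [cg gA]; split.
  by move=> x; exact: continuousM (cf x) (cg x).
move=> e e0; have [M M0 fM] := continuous_bounded compactX cf.
have [N N0 gN] := continuous_bounded compactX cg.
(* The error of the product is at most [d * N + M * d + d * d], and [d <= 1] makes the last term
   linear. *)
pose d := Num.min 1 (e / (M + N + 1)).
have MN : 0 < M + N + 1 by lra.
have d0 : 0 < d by rewrite lt_min ltr01 divr_gt0.
have d1 : d <= 1 by rewrite ge_min lexx.
have de : d * (M + N + 1) <= e.
  by rewrite -ler_pdivlMr// ge_min lexx orbT.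
have [f' Af' ff'] := fA _ d0; have [g' Ag' gg'] := gA _ d0.
exists (f' \* g'); first exact: AM.
move=> x /=.
have -> : f x * g x - f' x * g' x =
  (f x - f' x) * g x + (f x * (g x - g' x) - (f x - f' x) * (g x - g' x)) by ring.
apply: (le_trans (ler_normD _ _)); rewrite normrM.
apply: (@le_trans _ _ (d * N + (M * d + d * 1))); last by lra.
apply: lerD; first exact: ler_pM.
apply: (le_trans (ler_normB _ _)); rewrite !normrM.
by apply: lerD; apply: ler_pM => //; exact: le_trans (gg' x) d1.
Qed.

Lemma uniform_closure_cst c : B (cst c).
Proof. exact: subset_uniform_closure. Qed.

Lemma uniform_closureN f : B f -> B (\- f).
Proof.
move=> Bf; rewrite (_ : \- f = cst (- 1) \* f).
  exact: uniform_closureM (uniform_closure_cst _) Bf.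
by apply/funext => x /=; rewrite mulN1r.
Qed.

Lemma uniform_closure_norm f : B f -> B (fun x => `|f x|).
Proof.
move=> Bf; have [M M0 fM] := continuous_bounded compactX Bf.1.
pose K := M + 1; have K0 : 0 < K by rewrite /K; lra.
pose h := f \* cst K^-1.
have Bh : B h by exact: uniform_closureM (uniform_closure_cst _).
have h1 x : `|h x| <= 1.
  rewrite /h /= normrM normfV (gtr0_norm K0) ler_pdivrMr// mul1r.
  by have := fM x; rewrite /K; lra.
have Bq n : B (fun x => abs_approx (h x) n).
  elim: n => [|n IH]; first exact: uniform_closure_cst.
  pose q x := abs_approx (h x) n.
  rewrite (_ : (fun x => _) = q \+ ((h \* h) \+ (\- (q \* q))) \* cst 2^-1).
    apply: uniform_closureD => //; apply: uniform_closureM; last exact: uniform_closure_cst.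
    apply: uniform_closureD; first exact: uniform_closureM.
    by apply: uniform_closureN; exact: uniform_closureM.
  by apply/funext => x /=; rewrite !expr2.
have ca : continuous (fun x => `|f x|).
  by move=> x; apply: continuous_comp; [exact: Bf.1 | exact: norm_continuous].
apply: uniform_closureK => // e e0.
pose n := Num.bound (e^-1 * (2 * K)).
have ne : 2 / n.+1%:R <= e / K.
  rewrite ler_pdivrMr ?ltr0n// mulrAC ler_pdivlMr// mulrC -ler_pdivrMl//.
  rewrite mulrC; apply: ltW; apply: lt_le_trans (archi_boundP _) _.
    by rewrite mulr_ge0 ?invr_ge0 ?mulr_ge0 ?ltW.
  by rewrite -/n ler_nat.
exists (cst K \* (fun x => abs_approx (h x) n)).
  by apply: uniform_closureM => //; exact: uniform_closure_cst.
move=> x /=; have [/andP[q0 qh] qn] := abs_approxP n (h1 x).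
have -> : `|f x| = K * `|h x|.
  by rewrite /h /= normrM normfV (gtr0_norm K0) mulrCA mulfV ?mulr1// gt_eqF.
rewrite -mulrBr normrM (gtr0_norm K0) ger0_norm ?subr_ge0//.
by rewrite mulrC -ler_pdivlMr//; exact: le_trans qn ne.
Qed.

Lemma uniform_closure_max f g : B f -> B g -> B (fun x => Num.max (f x) (g x)).
Proof.
move=> Bf Bg.
rewrite (_ : (fun x => _) =
  ((f \+ g) \+ (fun x => `|(f \+ (\- g)) x|)) \* cst 2^-1); last first.
  by apply/funext => x /=; rewrite maxr_absE.
apply: uniform_closureM; last exact: uniform_closure_cst.
apply: uniform_closureD; first exact: uniform_closureD.
by apply/uniform_closure_norm/uniform_closureD => //; exact: uniform_closureN.
Qed.

Lemma uniform_closure_min f g : B f -> B g -> B (fun x => Num.min (f x) (g x)).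
Proof.
move=> Bf Bg.
rewrite (_ : (fun x => _) = \- (fun x => Num.max ((\- f) x) ((\- g) x))); last first.
  by apply/funext => x /=; rewrite -oppr_min opprK.
by apply/uniform_closureN/uniform_closure_max; exact: uniform_closureN.
Qed.

Lemma uniform_closure_interpolation x y (a b : R) : (x = y -> a = b) ->
  exists2 f, B f & f x = a /\ f y = b.
Proof.
move=> ab; have [xy|nxy] := pselect (x = y).
  exists (cst a); first exact: uniform_closure_cst.
  by rewrite (ab xy).
have [h Ah hxy] := A_separates nxy.
have hxy0 : h y - h x != 0 by rewrite subr_eq0; apply/eqP => /esym.
exists (cst a \+ ((h \+ cst (- h x)) \* cst ((b - a) / (h y - h x)))).
  apply: uniform_closureD; first exact: uniform_closure_cst.
  apply: uniform_closureM; last exact: uniform_closure_cst.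
  apply: uniform_closureD; last exact: uniform_closure_cst.
  exact: subset_uniform_closure.
by split=> /=; [rewrite subrr mul0r addr0 | rewrite mulrCA mulfV// mulr1 addrC subrK].
Qed.

Lemma near_lt f g x : continuous f -> continuous g -> f x < g x ->
  \forall y \near x, f y < g y.
Proof.
move=> cf cg fgx.
have : \forall y \near x, 0 < g y - f y.
  apply: (cvgr_gt (g x - f x)); last by rewrite subr_gt0.
  exact: continuousB (cg x) (cf x).
by apply: filterS => y; rewrite subr_gt0.
Qed.

(** Maxima of interpolants through [(x, f x)] give, for each [x], some [g] above [f - e] with
    [g x = f x]; minima of these over varying [x] also come below [f + e]. *)
Lemma stone_weierstrass f e : continuous f -> 0 < e ->
  exists2 g, A g & forall x, `|f x - g x| <= e.
Proof.
move=> cf; suff [_] : B f by apply.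
apply: uniform_closureK => // {}e e0.
have cfe (c : R) : continuous (fun y => f y + c).
  by move=> y; apply: continuousD (cf y) _; exact: cst_continuous.
have below x : exists2 g, B g /\ g x = f x & forall y, f y - e < g y.
  apply: (@compact_directed_cover _ _ (fun g => B g /\ g x = f x)
    (fun g h => forall y, g y <= h y) (fun g y => f y - e < g y)) => //.
  - by exists (cst (f x)); split=> //; exact: uniform_closure_cst.
  - move=> g h [Bg gx] [Bh hx]; exists (fun y => Num.max (g y) (h y)); split.
    + by split; [exact: uniform_closure_max | rewrite gx hx maxxx].
    + by move=> l kl y; apply: le_trans (kl y); rewrite le_max lexx.
    + by move=> l kl y; apply: le_trans (kl y); rewrite le_max lexx orbT.
  - by move=> g h y gh /lt_le_trans; apply.
  - move=> y; have [|g Bg [gx gy]] := @uniform_closure_interpolation x y (f x) (f y).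
      by move=> ->.
    exists g => //; apply: near_lt => //; first exact: Bg.1.
    by rewrite gy; lra.
have [g [Bg gf] gf'] : exists2 g, B g /\ (forall y, f y - e < g y) &
    forall y, g y < f y + e.
  apply: (@compact_directed_cover _ _ (fun g => B g /\ (forall y, f y - e < g y))
    (fun g h => forall y, h y <= g y) (fun g y => g y < f y + e)) => //.
  (* The index set must be inhabited even when [X] is empty; then any constant serves. *)
  - have [[x _]|nX] := pselect (exists x : X, True).
      by have [g [Bg _] gf] := below x; exists g.
    exists (cst 0); split; first exact: uniform_closure_cst.
    by move=> y; exfalso; apply: nX; exists y.
  - move=> g h [Bg gx] [Bh hx]; exists (fun y => Num.min (g y) (h y)); split.
    + by split; [exact: uniform_closure_min | move=> y; rewrite lt_min gx hx].
    + by move=> l kl y; apply: le_trans (kl y) _; rewrite ge_min lexx.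
    + by move=> l kl y; apply: le_trans (kl y) _; rewrite ge_min lexx orbT.
  - by move=> g h y gh; exact: le_lt_trans.
  - move=> y; have [g [Bg gy] gf] := below y.
    exists g => //; apply: near_lt => //; first exact: Bg.1.
    by rewrite gy; lra.
exists g => // x; have := gf x; have := gf' x.
by rewrite ler_distlC => a b; apply/andP; split; lra.
Qed.

End StoneWeierstrass.

(** * Topology and torsion of the circle *)

Section ComplexTopology.
Variable R : realType.

(** Radii of balls in [R[i]] are complex numbers, and the order forces a positive one to be real. *)
Lemma complex_gt0E (e : R[i]) : 0 < e -> 0 < complex.Re e /\ e = (complex.Re e)%:C.
Proof. by case: e => a b; rewrite ltcE /= => /andP[/eqP -> a0]. Qed.

Lemma continuous_real_complex : continuous (fun x : R => x%:C).
Proof.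
move=> x; apply/cvgrPdist_lt => e /complex_gt0E[e0 ->].
have := @cvg_id _ (nbhs x) => /cvgrPdist_lt/(_ _ e0).
apply: filterS => y xy.
by rewrite -rmorphB normc_def /= expr0n addr0 sqrtr_sqr ltcR.
Qed.

Lemma continuous_Re : continuous (fun z : R[i] => complex.Re z).
Proof.
move=> z V /nbhs_normP[e /= e0 eV].
have eC : 0 < e%:C :> R[i] by rewrite ltcR.
exists e%:C => // y /= zy; apply: eV; rewrite /= -raddfB.
apply: (le_lt_trans (ge_Re_normc _)).
by move: zy; rewrite normc_def ltcR; case: (z - y).
Qed.

Lemma continuous_toC : continuous (@toC R).
Proof. exact: initial_continuous. Qed.

Definition cis (t : R) : R[i] := cos t +i* sin t.

Lemma cisD s t : cis (s + t) = cis s * cis t.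
Proof. by rewrite /cis cosD sinD; congr Complex => /=; ring. Qed.

Lemma cis0 : cis 0 = 1.
Proof. by rewrite /cis cos0 sin0. Qed.

Lemma cisMn t n : cis (n%:R * t) = cis t ^+ n.
Proof.
elim: n => [|n IH]; first by rewrite mul0r cis0.
by rewrite -natr1 mulrDl mul1r cisD IH exprSr.
Qed.

Lemma norm_cis t : `|cis t| = 1.
Proof. by rewrite normc_def /= cos2Dsin2 sqrtr1. Qed.

Lemma cis2pi : cis (2 * pi) = 1.
Proof. by rewrite mulr_natl /cis cos2pi sin2pi. Qed.

Lemma continuous_cis : continuous cis.
Proof.
have -> : cis = (fun t => (cos t)%:C + 'i * (sin t)%:C).
  apply/funext => t; rewrite /cis; congr Complex; rewrite /=; ring.
move=> t; apply: (@cvgD R[i] (R[i]^o)).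
  by apply: continuous_comp; [exact: continuous_cos | exact: continuous_real_complex].
apply: (@cvgM R[i]); first exact: cvg_cst.
by apply: continuous_comp; [exact: continuous_sin | exact: continuous_real_complex].
Qed.

Definition circle_cis t : circle R := mk_circle (norm_cis t).

Lemma continuous_circle_cis : continuous circle_cis.
Proof. by apply: continuous_comp_initial; exact: continuous_cis. Qed.

Lemma circle_cis_surj (x : circle R) : exists2 t, - pi <= t <= pi & x = circle_cis t.
Proof.
have := circle_norm x; rewrite normc_def => -[].
have : toC x = complex.Re (toC x) +i* complex.Im (toC x) by case: (toC x).
set a := complex.Re _; set b := complex.Im _ => xE ab.
have {}ab : a ^+ 2 + b ^+ 2 = 1.
  by rewrite -[LHS]sqr_sqrtr ?addr_ge0 ?sqr_ge0// ab expr1n.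
have a1 : -1 <= a <= 1 by have := sqr_ge0 b; move: ab => ? ?; apply/andP; split; nra.
have p0 := @pi_gt0 R.
have sa : sin (acos a) = `|b|.
  by rewrite sin_acos// (_ : 1 - a ^+ 2 = b ^+ 2) ?sqrtr_sqr//; lra.
have ca : cos (acos a) = a by rewrite acosK// in_itv.
have := acos_ge0 a1; have := acos_lepi a1 => h1 h2.
have [b0|b0] := leP 0 b.
  exists (acos a); first by apply/andP; split; lra.
  by apply: toC_inj; rewrite xE -[RHS]/(cis _) /cis ca sa ger0_norm.
exists (- acos a); first by apply/andP; split; lra.
by apply: toC_inj; rewrite xE -[RHS]/(cis _) /cis cosN sinN ca sa ltr0_norm// opprK.
Qed.

Lemma compact_circle : compact [set: circle R].
Proof.
have -> : [set: circle R] = circle_cis @` `[- pi, pi].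
  apply/seteqP; split=> // x _; have [t tpi ->] := circle_cis_surj x.
  by exists t => //; rewrite /= in_itv.
apply: continuous_compact; last exact: segment_compact.
by apply: continuous_subspaceT; exact: continuous_circle_cis.
Qed.

Lemma cis_ratr n i :
  cis (2 * pi * ratr n%:R^-1) ^+ i = cis (2 * pi * ratr (i%:R / n%:R)) :> R[i].
Proof.
by rewrite -cisMn; congr cis; rewrite rmorphM /= ratr_nat; ring.
Qed.

(** If the order [m] were less than [n], then [u = pi * m / n] would lie strictly between 0 and [pi]
    with [cos (2 * u) = 1], that is [sin u = 0]. *)
Lemma prim_root_cis n : (0 < n)%N ->
  n.-primitive_root (cis (2 * pi * ratr n%:R^-1)).
Proof.
move=> n0; set y := cis _.
have yX i : y ^+ i = cis (2 * pi * ratr (i%:R / n%:R)) := cis_ratr n i.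
have n0' : n%:R != 0 :> rat by rewrite pnatr_eq0 -lt0n.
have nR : 0 < n%:R :> R by rewrite ltr0n.
have [m ym mn] : {m | m.-primitive_root y & (m %| n)%N}.
  by apply: prim_order_exists => //; rewrite yX mulfV// rmorph1 mulr1 cis2pi.
have [mn'|nm] := ltnP m n; last first.
  by rewrite (_ : n = m)//; apply/eqP; rewrite eqn_leq nm dvdn_leq.
have m0 := prim_order_gt0 ym.
have := prim_expr_order ym; rewrite yX /cis => -[+ _].
pose u : R := pi * (m%:R / n%:R).
have -> : 2 * pi * ratr (m%:R / n%:R) = u + u :> R.
  by rewrite rmorphM /= fmorphV /= !ratr_nat /u; ring.
rewrite cosD -!expr2 cos2sin2 => su.
have : 0 < sin u.
  apply: sin_gt0_pi; have p0 := @pi_gt0 R; apply/andP; split.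
    by rewrite /u mulr_gt0// divr_gt0// ltr0n.
  by rewrite /u gtr_pMr// ltr_pdivrMr// mul1r ltr_nat.
by move=> /(exprn_gt0 2) s0; exfalso; clear -su s0; lra.
Qed.

Lemma circleQP (x : circle R) :
  circleQ x <-> exists2 n, (0 < n)%N & (x ^+ n = 1)%g.
Proof.
split=> [[q]|[n n0 xn]].
  rewrite -/(cis _) => xq.
  have [d d0 dq] : exists2 d, (0 < d)%N & exists a : int, d%:R * ratr q = a%:~R :> R.
    exists `|denq q|%N; first by rewrite absz_gt0 denq_neq0.
    exists (numq q); rewrite /ratr.
    rewrite -[_%:R]/(`|denq q|%N%:Z%:~R) absz_denq mulrC divfK//.
    by rewrite intr_eq0 denq_neq0.
  exists d => //; apply: toC_inj; rewrite toCX xq -cisMn mulrCA.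
  have [a ->] := dq; case: a => m.
    by rewrite mulrC cisMn cis2pi expr1n.
  (* A negative numerator is treated by multiplying with [cis] of the opposite angle, which is 1. *)
  have : cis (2 * pi * m.+1%:R) = 1 by rewrite mulrC cisMn cis2pi expr1n.
  rewrite NegzE mulrNz mulrN => h.
  by rewrite -[LHS]mulr1 -[X in _ * X]h -cisD addNr cis0.
have yn := prim_root_cis n0.
have xn1 : toC x ^+ n = 1 by rewrite -toCX xn.
have [i xi] := prim_rootP yn xn1.
by exists (i%:R / n%:R); rewrite xi cis_ratr.
Qed.

End ComplexTopology.

(** * Compactness of the space of sequences *)

Section HspaceCompact.
Variable R : realType.
Local Notation T1 := (circle R).
Local Notation Hprod := {ptws nat -> {ptws T1 -> T1}}.

(** If [m] is the exact order of [x], then [psi x] is an [m]-th root of unity, and [x] generates all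
    of these. The bound on [a] leaves finitely many cases, which [stirling_cond] needs. *)
Lemma torsion_hom (psi : T1 -> T1) (x : T1) n :
  {morph psi : x y / (x * y)%g} -> (0 < n)%N -> (x ^+ n = 1)%g ->
  exists2 a, (a < n)%N & psi x = (x ^+ a)%g.
Proof.
move=> psiM n0 xn; have xn1 : toC x ^+ n = 1 by rewrite -toCX xn.
have [m xm mn] := prim_order_exists n0 xn1.
have xm1 : (x ^+ m = 1)%g.
  by apply: toC_inj; rewrite toCX (prim_expr_order xm).
have pm : toC (psi x) ^+ m = 1 by rewrite -toCX -homX// xm1 hom1.
have [i xi] := prim_rootP xm pm.
exists i; first by apply: leq_trans (ltn_ord i) _; exact: dvdn_leq.
by apply: toC_inj; rewrite toCX.
Qed.

Lemma iter_torsion_hom (psi : T1 -> T1) (x : T1) a j (z : int) :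
  {morph psi : x y / (x * y)%g} -> psi x = (x ^+ a)%g ->
  iter j psi (expgz x z) = expgz (x ^+ (a ^ j)%N)%g z.
Proof.
move=> psiM xa; rewrite (homz (iter_hom psiM j)); congr expgz.
elim: j => [|j IH]; first by rewrite expn0 expg1.
by rewrite iterS IH homX// xa -expgnA expnS.
Qed.

Definition eval_at k x (phi : Hprod) : T1 := phi k x.

Lemma continuous_eval_at k x : continuous (eval_at k x).
Proof.
move=> phi; apply: (@continuous_comp _ _ _
  (fun phi : Hprod => (phi k : {ptws T1 -> T1})) (fun f : {ptws T1 -> T1} => f x)).
  exact: (@proj_continuous nat (fun=> {ptws T1 -> T1}) k).
exact: (@proj_continuous T1 (fun=> T1) x).
Qed.

Lemma continuous_toC_eval k x : continuous (fun phi => toC (eval_at k x phi)).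
Proof.
by move=> phi; apply: continuous_comp; [exact: continuous_eval_at | exact: continuous_toC].
Qed.

Lemma closed_eq_continuous (T : topologicalType) (F G : T -> R[i]) :
  continuous F -> continuous G -> closed [set x | F x = G x].
Proof.
move=> cF cG.
rewrite (_ : [set _ | _] = (fun x => F x - G x) @^-1` [set 0]); last first.
  by apply/seteqP; split=> x /=; [move=> ->; rewrite subrr | move/subr0_eq].
apply: preimage_closed.
  by move=> x _; apply: (@cvgB R[i] (R[i]^o)); [exact: cF | exact: cG].
exact: (accessible_closed_set1 (hausdorff_accessible (@norm_hausdorff R[i] (R[i]^o)))).
Qed.

(* [phi |-> phi (phi x)] is not continuous for pointwise convergence, but at a
   torsion point [x] it is locally constant: [phi 1 x] is one of finitely many
   powers [x ^+ a].  Splitting according to [a] makes the defining relation of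
   the space a finite union of closed conditions. *)
Definition stirling_cond k x n : set Hprod := [set phi | exists2 a, (a < n)%N &
  phi 1%N x = (x ^+ a)%g /\
  phi k (x ^+ k`!)%g = (\prod_(1 <= j < k.+1) expgz (x ^+ (a ^ j)%N)%g (stirling1 k j))%g].

Lemma stirling_condP k x n (phi : Hprod) : circle_hom (phi 1%N) ->
  (0 < n)%N -> (x ^+ n = 1)%g ->
  stirling_cond k x n phi <->
  phi k (x ^+ k`!)%g =
    (\prod_(1 <= j < k.+1) iter j (phi 1%N) (expgz x (stirling1 k j)))%g.
Proof.
move=> phiM n0 xn; split=> [[a _ [xa ->]]|phiE].
  by apply: eq_bigr => j _; rewrite (iter_torsion_hom _ _ phiM xa).
have [a an xa] := torsion_hom phiM n0 xn; exists a => //; split=> //.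
by rewrite phiE; apply: eq_bigr => j _; rewrite (iter_torsion_hom _ _ phiM xa).
Qed.

Lemma closed_eval_eq k x (y : T1) : closed [set phi : Hprod | phi k x = y].
Proof.
rewrite (_ : [set _ | _] = [set phi | toC (eval_at k x phi) = toC y]).
  apply: closed_eq_continuous; first exact: continuous_toC_eval.
  by move=> ?; exact: cst_continuous.
by apply/seteqP; split=> phi /=; [move=> <- | move/toC_inj].
Qed.

Lemma closed_stirling_cond k x n : closed (stirling_cond k x n).
Proof.
rewrite (_ : stirling_cond k x n = \bigcup_(a in `I_n)
  ([set phi : Hprod | phi 1%N x = (x ^+ a)%g] `&` [set phi : Hprod | phi k (x ^+ k`!)%g =
    (\prod_(1 <= j < k.+1) expgz (x ^+ (a ^ j)%N)%g (stirling1 k j))%g])) //.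
apply: closed_bigcup; first exact: finite_II.
by move=> a _; apply: closedI; exact: closed_eval_eq.
Qed.

Lemma closed_Hset : closed (@Hset R).
Proof.
have -> : @Hset R =
    (\bigcap_(p in [set: nat * (T1 * T1)])
       [set phi : Hprod | phi p.1 (p.2.1 * p.2.2)%g = (phi p.1 p.2.1 * phi p.1 p.2.2)%g]) `&`
    (\bigcap_(x in [set: T1]) [set phi : Hprod | phi 0%N x = x]) `&`
    (* Rational points are replaced by torsion points paired with an exponent, which bounds the
       range of [a] in [stirling_cond]. *)
    (\bigcap_(p in [set p : nat * (T1 * nat) |
        [/\ (0 < p.1)%N, (0 < p.2.2)%N & (p.2.1 ^+ p.2.2 = 1)%g]])
       stirling_cond p.1 p.2.1 p.2.2).
  apply/seteqP; split=> phi /=.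
    move=> [phiM phi0 phiS]; split; first split.
    - by move=> [k [x y]] _ /=; exact: phiM.
    - by move=> x _ /=; rewrite phi0.
    - move=> [k [x n]] [/= k0 n0 xn]; apply/stirling_condP => //.
      by apply: phiS => //; apply/circleQP; exists n.
  move=> [[phiM phi0] phiS].
  have phiM' k : circle_hom (phi k) by move=> x y; exact: (phiM (k, (x, y)) I).
  split=> //.
    by apply/funext => x; exact: phi0.
  move=> k x k0 /circleQP[n n0 xn].
  apply/(@stirling_condP k x n) => //.
  exact: (phiS (k, (x, n))).
apply: closedI; first apply: closedI.
- apply: closed_bigI => -[k [x y]] _ /=.
  rewrite (_ : [set _ | _] = [set phi | toC (eval_at k (x * y)%g phi) =
     toC (eval_at k x phi) * toC (eval_at k y phi)]).
    apply: closed_eq_continuous; first exact: continuous_toC_eval.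
    move=> phi; exact: (@cvgM R[i] _ _ _ _ _ _ _
      (@continuous_toC_eval k x phi) (@continuous_toC_eval k y phi)).
  by apply/seteqP; split=> phi /=; [move=> h; rewrite /eval_at h | rewrite -toCM => /toC_inj].
- by apply: closed_bigI => x _; exact: closed_eval_eq.
- by apply: closed_bigI => p _; exact: closed_stirling_cond.
Qed.

Lemma compact_Hprod : compact [set: Hprod].
Proof.
have c1 : compact [set: {ptws T1 -> T1}].
  have := @tychonoff T1 (fun=> T1) (fun=> setT) (fun=> @compact_circle R).
  by rewrite (_ : [set _ | _] = setT)//; apply/seteqP; split.
have := @tychonoff nat (fun=> {ptws T1 -> T1}) (fun=> setT) (fun=> c1).
by rewrite (_ : [set _ | _] = setT)//; apply/seteqP; split.
Qed.

Lemma compact_Hset : compact (@Hset R).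
Proof. exact: subclosed_compact closed_Hset compact_Hprod _. Qed.

End HspaceCompact.

Lemma compact_set_type (T : topologicalType) (A : set T) :
  compact A -> compact [set: set_type A].
Proof.
move=> cA F FF _.
have [|x [Ax clx]] := cA (set_val @ F) (fmap_proper_filter _ FF).
  by apply: (@filterS _ F _ setT _ _ filterT) => x _; exact: set_valP.
exists (exist _ x (mem_set Ax)); split=> // B C FB.
move=> [_ [[V oV <-] Vx VC]].
have FB' : F (set_val @^-1` (set_val @` B)).
  by apply: (filterS _ FB) => b Bb; exists b.
have [y []] := clx (set_val @` B) V FB' (open_nbhs_nbhs (conj oV Vx)).
by move=> [b Bb <-] Vb; exists b; split=> //; exact: VC.
Qed.

Lemma compact_Hspace (R : realType) : compact [set: Hspace R].
Proof. exact: compact_set_type (@compact_Hset R). Qed.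

(** * Systems with quasi-discrete spectrum *)

Section ConstantMeans.
Variables (R : realType) (X : Type) (s : X -> X).
Implicit Types F G : X -> R[i].

Definition constant_mean F : Prop :=
  exists c, forall x, mean_zero (fun n => F (iter n s x) - c).

Lemma constant_mean_comb n (c : 'I_n -> R[i]) (F : 'I_n -> X -> R[i]) :
  (forall i, constant_mean (F i)) ->
  constant_mean (fun x => \sum_(i < n) c i * F i x).
Proof.
move=> /choice[m Fm]; exists (\sum_(i < n) c i * m i) => x.
apply: (@eq_mean_zero _ (fun k => \sum_(i < n) c i * (F i (iter k s x) - m i))).
  by move=> k; rewrite -sumrB; apply: eq_bigr => i _; rewrite mulrBr.
by apply: mean_zero_sum => i _; apply: mean_zeroZ; exact: Fm.
Qed.

Lemma constant_mean_approx (f : X -> R) :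
  (forall e : R, 0 < e -> exists2 F, constant_mean F &
    forall x, `|f x - complex.Re (F x)| <= e) ->
  has_approx_mean s f.
Proof.
move=> fF e e0; have e20 : 0 < e / 2 by lra.
have [F [c Fc] fFe] := fF _ e20.
exists (complex.Re c) => x; have [N0 h] := Fc x _ e20.
exists N0 => N /h {}h.
have -> : birkhoff_sum s f x N - complex.Re c * N%:R =
    \sum_(n < N) (f (iter n s x) - complex.Re (F (iter n s x))) +
    complex.Re (\sum_(n < N) (F (iter n s x) - c)).
  rewrite !(raddf_sum (@complex.Re R)) -big_split /=.
  rewrite (eq_bigr (fun n : 'I_N => f (iter n s x) - complex.Re c)).
    by rewrite sumrB sumr_const card_ord mulr_natr.
  by move=> n _; rewrite raddfB /= addrA subrK.
have -> : e * N%:R = e / 2 * N%:R + e / 2 * N%:R by field.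
apply: (le_trans (ler_normD _ _)); apply: lerD.
  apply: (le_trans (ler_norm_sum _ _ _)).
  apply: (@le_trans _ _ (\sum_(n < N) (e / 2))); first exact: ler_sum.
  by rewrite sumr_const card_ord mulr_natr.
exact: le_trans (ge_Re_normc _) h.
Qed.

Lemma constant_mean_window F (B : R) N C : (0 < N)%N -> (forall x, normc (F x) <= B) ->
  (forall x, \sum_(n < N) F (iter n s x) = C) -> constant_mean F.
Proof.
move=> N0 FB FC; exists (C / N%:R) => x.
apply: (@mean_zero_periodic _ _ (B + normc (C / N%:R)) N) => // n.
  by apply: (le_trans (le_normcD _ _)); rewrite normcN lerD.
rewrite sumrB sumr_const card_ord -[X in _ - X]mulr_natr divfK ?pnatr_eq0 -?lt0n//.
by under eq_bigr do rewrite addnC iterD; rewrite FC subrr.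
Qed.

(* A character [F 0] together with its iterated coboundaries [F 1, F 2, ...]. *)
Definition phase_family (F : nat -> X -> circle R) : Prop :=
  forall i x, F i (s x) = (F i x * F i.+1 x)%g.

Lemma phase_family_sequence (F : nat -> X -> circle R) x : phase_family F ->
  phase_sequence (fun i n => F i (iter n s x)).
Proof. by move=> FS i n; rewrite iterS FS. Qed.

(** The last two hypotheses isolate what depends on the system: whether the last coefficient not yet
    known to be torsion is so at all points or at none, and whether a window sum over a period is
    constant. The index [j] beyond which everything is [d]-torsion descends until a nontorsion
    coefficient appears or [j = 0]. *)
Lemma phase_family_constant_mean (F : nat -> X -> circle R) K :
  phase_family F -> (forall i x, (K < i)%N -> F i x = 1%g) ->
  (forall j d, (0 < d)%N -> (forall i x, (j < i)%N -> (F i x ^+ d)%g = 1%g) ->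
     (forall x, nontorsion (F j x)) \/
     (exists2 e, (0 < e)%N & forall x, (F j x ^+ e)%g = 1%g)) ->
  (forall d N, (0 < d)%N -> (forall i x, (0 < i)%N -> (F i x ^+ d)%g = 1%g) ->
     (0 < N)%N -> (forall x, F 0%N (iter N s x) = F 0%N x) ->
     exists C, forall x, \sum_(n < N) toC (F 0%N (iter n s x)) = C) ->
  constant_mean (fun x => toC (F 0%N x)).
Proof.
move=> FS FK dich per.
suff H j d : (0 < d)%N -> (forall i x, (j < i)%N -> (F i x ^+ d)%g = 1%g) ->
    constant_mean (fun x => toC (F 0%N x)).
  by apply: (H K 1%N) => // i x Ki; rewrite FK// expg1n.
elim: j d => [|j IH] d d0 Fd.
  (* [d ^ K.+1] is the period that [phase_periodic] gives for [F 0], the same for all starting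
     points. *)
  have N0 : (0 < d ^ K.+1)%N by rewrite expn_gt0 d0.
  have [|C FC] := per d (d ^ K.+1)%N d0 Fd N0.
    move=> x; have := @phase_periodic R _ d 0 K (phase_family_sequence x FS).
    move=> /(_ (fun i n => FK i _) (fun i n => Fd i _) K.+1 0%N (leqnn _)).
    by move=> /(_ (ltnSn _) 0%N).
  by apply: (@constant_mean_window _ 1 _ C N0) => // x; rewrite normc_toC.
have [nt|[e e0 Fe]] := dich _ _ d0 Fd; last first.
  apply: (IH (d * e)%N); first by rewrite muln_gt0 d0.
  move=> i x; rewrite leq_eqVlt => /orP[/eqP <-|ji].
    by rewrite mulnC expgnA Fe expg1n.
  by rewrite expgnA Fd ?expg1n.
exists 0 => x; apply: (@eq_mean_zero _ (fun n => toC (F 0%N (iter n s x)))).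
  by move=> n; rewrite subr0.
apply: (@phase_mean_zero R (fun i n => F i (iter n s x)) d j K) => //.
- exact: phase_family_sequence.
- by move=> i n; exact: FK.
- by move=> i n; exact: Fd.
Qed.

Lemma window_invariant (F : X -> R[i]) N : (forall x, F (iter N s x) = F x) ->
  forall x, \sum_(n < N) F (iter n s (s x)) = \sum_(n < N) F (iter n s x).
Proof.
move=> FN x; apply: (addrI (F x)).
transitivity (\sum_(n < N.+1) F (iter n s x)).
  by rewrite big_ord_recl; congr (_ + _); apply: eq_bigr => n _; rewrite -iterSr.
by rewrite big_ord_recr /= FN addrC.
Qed.

End ConstantMeans.

(** * Quasi-eigenfunctions of a minimal system *)

Section QuasiDiscrete.
Variables (R : realType) (X : ptopologicalType) (s : X -> X).
Hypothesis cs : continuous s.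
Hypothesis minX : minimal_system s.

Lemma minimal_invariant_cst (F : X -> R[i]) : continuous F ->
  (forall x, F (s x) = F x) -> forall x, F x = F point.
Proof.
move=> cF Fs x; apply: contrapT => nx.
have cE : closed [set y | F y = F point].
  by apply: (closed_eq_continuous cF) => y; exact: cvg_cst.
have Fn n y : F (iter n s y) = F y by elim: n => // n IH; rewrite iterS Fs.
have /(_ (~` [set y | F y = F point]) (ex_intro _ x nx) (closed_openC cE)) := minX point.
move=> [y [/= ny [n [ny'|ny']]]].
- by apply: ny; rewrite -ny' Fn.
- by apply: ny; rewrite -(Fn n) ny'.
Qed.

Lemma Gset_phase_family m (g : X -> circle R) : Gset s m g -> exists F : nat -> X -> circle R,
  [/\ F 0%N = g, phase_family s F, forall i x, (m < i)%N -> F i x = 1%g &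
      forall i, continuous (F i)].
Proof.
elim: m g => [|m IH] g.
  move=> [c ->]; exists (fun i => if i is 0%N then cst c else cst 1%g); split=> //.
  - by case=> [|i] x /=; rewrite mulg1.
  - by case.
  - by case=> [|i] x; exact: cst_continuous.
move=> [cg [f /IH[F [F0 FS Fm Fc]] gs]].
exists (fun i => if i is i'.+1 then F i' else g); split=> //.
- by case=> [|i] x /=; [rewrite gs F0 circle_mulgC | exact: FS].
- by case=> // i x; exact: Fm.
- by case.
Qed.

Lemma Gset_constant_mean m (g : X -> circle R) : Gset s m g -> constant_mean s (fun x => toC (g x)).
Proof.
move=> /Gset_phase_family[F [<- FS Fm Fc]].
have cC i : continuous (fun x => toC (F i x)).
  by move=> x; apply: continuous_comp; [exact: Fc | exact: continuous_toC].
have cX i d : continuous (fun x => toC (F i x) ^+ d).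
  elim: d => [|d IH] x; first exact: cvg_cst.
  under [X in continuous_at _ X]funext do rewrite exprS.
  by apply: (@cvgM R[i]); [exact: (cC i x) | exact: IH].
apply: (phase_family_constant_mean FS Fm) => [j d d0 Fd|d N d0 Fd N0 FN].
  (* [F j] itself need not be invariant, but its [d]-th power is, since [F j.+1 ^ d = 1]. Torsion
     thus spreads from one point to all, with exponent [d * e] in place of [e]. *)
  have Fj x : (F j x ^+ d)%g = (F j point ^+ d)%g.
    apply: toC_inj; rewrite !toCX.
    apply: (minimal_invariant_cst (cX j d)) => y.
    by rewrite -!toCX FS circle_expgM (Fd j.+1)// mulg1.
  have [[e e0 Fe]|nt] := pselect (exists2 e, (0 < e)%N & (F j point ^+ e)%g = 1%g).
    right; exists (d * e)%N; first by rewrite muln_gt0 d0.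
    by move=> x; rewrite expgnA Fj -expgnA mulnC expgnA Fe expg1n.
  left=> x e e0 Fe; apply: nt; exists (d * e)%N; first by rewrite muln_gt0 d0.
  by rewrite expgnA -(Fj x) -expgnA mulnC expgnA Fe expg1n.
exists (\sum_(n < N) toC (F 0%N (iter n s point))).
apply: minimal_invariant_cst => [x|].
  have ci n : continuous (iter n s).
    elim: n => [|n IH] y; first exact: cvg_id.
    by apply: (@continuous_comp _ _ _ (iter n s) s); [exact: IH | exact: cs].
  elim: (N) => [|n IH].
    under [X in continuous_at _ X]funext do rewrite big_ord0.
    exact: cst_continuous.
  under [X in continuous_at _ X]funext do rewrite big_ord_recr.
  apply: (@cvgD R[i] (R[i]^o)); first exact: IH.
  by apply: (@continuous_comp _ _ _ (iter n s) (fun x => toC (F 0%N x)));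
    [exact: ci | exact: cC].
apply: (@window_invariant _ _ _ (fun x => toC (F 0%N x))) => x.
by rewrite FN.
Qed.

Lemma quasi_discrete_approx_mean : quasi_discrete_spectrum R s ->
  forall f : X -> R, continuous f -> has_approx_mean s f.
Proof.
move=> qds f cf; apply: constant_mean_approx => e e0.
have cfC : continuous (fun x => (f x)%:C).
  by move=> x; apply: continuous_comp; [exact: cf | exact: continuous_real_complex].
have [F [n [c [g [Gg FE]]]] fF] := qds _ cfC e e0.
exists F.
  rewrite FE; apply: (@constant_mean_comb _ _ _ _ _ (fun i x => toC (g i x))) => i.
  by have [m _ /Gset_constant_mean] := Gg i.
move=> x; have := fF x; rewrite normc_def lecR => /(le_trans _); apply.
have := ge_Re_normc ((f x)%:C - F x); rewrite raddfB /= => /le_trans; apply.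
by case: (F x).
Qed.

End QuasiDiscrete.

(** * Characters of the space of sequences *)

Section SpanDensity.
Variables (R : realType) (X : topologicalType).
Variable G : set (X -> circle R).
Hypothesis compactX : compact [set: X].
Hypothesis G_continuous : forall g, G g -> continuous g.
Hypothesis G1 : G (fun=> 1%g).
Hypothesis GM : forall g h, G g -> G h -> G (fun x => (g x * h x)%g).
Hypothesis GV : forall g, G g -> G (fun x => (g x)^-1%g).
Hypothesis G_separates : forall x y, x <> y -> exists2 g, G g & g x <> g y.
Local Notation span := (linear_span G).
Implicit Types (E F : X -> R[i]) (g : X -> circle R).

Lemma spanZ c F : span F -> span (fun x => c * F x).
Proof.
move=> [n [a [g [Gg ->]]]]; exists n, (fun i => c * a i), g; split=> //.
by apply/funext => x; rewrite mulr_sumr; apply: eq_bigr => i _; rewrite mulrA.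
Qed.

Lemma spanD E F : span E -> span F -> span (fun x => E x + F x).
Proof.
move=> [n [a [g [Gg ->]]]] [m [b [h [Gh ->]]]].
exists (n + m)%N, (fun i => match fintype.split i with inl j => a j | inr k => b k end),
  (fun i => match fintype.split i with inl j => g j | inr k => h k end); split.
  by move=> i; case: fintype.split.
apply/funext => x; rewrite big_split_ord /=; congr (_ + _); apply: eq_bigr => i _.
  by rewrite (unsplitK (inl i : 'I_n + 'I_m)).
by rewrite (unsplitK (inr i : 'I_n + 'I_m)).
Qed.

Lemma span_gen g : G g -> span (fun x => toC (g x)).
Proof.
move=> Gg; exists 1%N, (fun=> 1), (fun=> g); split=> //.
by apply/funext => x; rewrite big_ord1 mul1r.
Qed.

Lemma span_sum n (F : 'I_n -> X -> R[i]) : (forall i, span (F i)) ->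
  span (fun x => \sum_(i < n) F i x).
Proof.
elim: n F => [|n IH] F FS.
  exists 0%N, (fun=> 0), (fun _ _ => 1%g); split; first by case.
  by apply/funext => x; rewrite !big_ord0.
rewrite (_ : (fun _ => _) = fun x => \sum_(i < n) F (widen_ord (leqnSn n) i) x + F ord_max x).
  by apply: spanD => //; exact: IH.
by apply/funext => x; rewrite big_ord_recr.
Qed.

Lemma spanM E F : span E -> span F -> span (fun x => E x * F x).
Proof.
move=> [n [a [g [Gg ->]]]] [m [b [h [Gh ->]]]].
rewrite (_ : (fun _ => _) = fun x => \sum_(i < n) \sum_(j < m)
    (a i * b j) * toC (g i x * h j x)%g).
  apply: span_sum => i; apply: span_sum => j; apply: spanZ.
  by apply: (span_gen (g := fun x => (g i x * h j x)%g)); exact: GM.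
apply/funext => x; rewrite mulr_suml; apply: eq_bigr => i _.
rewrite mulr_sumr; apply: eq_bigr => j _.
by rewrite toCM mulrACA.
Qed.

Lemma span_conj F : span F -> span (fun x => (F x)^*).
Proof.
move=> [n [a [g [Gg ->]]]].
exists n, (fun i => (a i)^*), (fun i x => (g i x)^-1%g); split.
  by move=> i; exact: GV.
apply/funext => x; rewrite rmorph_sum; apply: eq_bigr => i _.
by rewrite rmorphM toCV.
Qed.

Lemma span_cst c : span (fun=> c).
Proof.
rewrite (_ : (fun=> c) = fun x => c * toC ((fun=> 1%g : circle R) x)).
  by apply: spanZ; exact: span_gen.
by apply/funext => x; rewrite mulr1.
Qed.

Lemma continuous_span F : span F -> continuous F.
Proof.
move=> [n [a [g [Gg ->]]]]; elim: n a g Gg => [|n IH] a g Gg x.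
  under [X in continuous_at _ X]funext do rewrite big_ord0.
  exact: cvg_cst.
under [X in continuous_at _ X]funext do rewrite big_ord_recr.
apply: (@cvgD R[i] (R[i]^o)).
  exact: (IH (fun i => a (widen_ord (leqnSn n) i)) (fun i => g (widen_ord (leqnSn n) i))).
apply: (@cvgM R[i]); first exact: cvg_cst.
by apply: continuous_comp; [exact: G_continuous | exact: continuous_toC].
Qed.

Lemma span_dense (f : X -> R) e : continuous f -> 0 < e ->
  exists2 F, span F & forall x, `|f x - complex.Re (F x)| <= e.
Proof.
move=> cf e0.
pose A : set (X -> R) := [set h | exists2 F, span F & h = fun x => complex.Re (F x)].
have [| | | | |h [F FS ->] fF] := @stone_weierstrass R X compactX A _ _ _ _ _ f e cf e0.
- move=> h [F FS ->] x.
  by apply: (@continuous_comp _ _ _ F (fun z : R[i] => complex.Re z));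
    [exact: continuous_span | exact: continuous_Re].
- by move=> c; exists (fun=> c%:C); first exact: span_cst.
- move=> _ _ [E ES ->] [F FS ->]; exists (fun x => E x + F x); first exact: spanD.
  by apply/funext => x; rewrite raddfD.
- move=> _ _ [E ES ->] [F FS ->].
  (* Real parts are not multiplicative, but [Re E * Re F] is the real part of this element, and the
     span is stable under conjugation because [G] is stable under inverses. *)
  exists (fun x => (2^-1)%:C * (E x * F x + E x * (F x)^*)).
    apply: spanZ; apply: spanD; first exact: spanM.
    by apply: spanM => //; exact: span_conj.
  by apply/funext => x /=; case: (E x) (F x) => [a b] [c d] /=; field.
- move=> x y /G_separates[g Gg gxy].
  have [Rexy|Rexy] := pselect (complex.Re (toC (g x)) = complex.Re (toC (g y))).
    (* Equal real parts leave the imaginary parts to separate, and [Re (i z) = - Im z]. *)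
    exists (fun x => complex.Re ('i * (toC (g x)))).
      exists (fun x => 'i * toC (g x)) => //.
      by apply: spanZ; exact: span_gen.
    move=> Imxy; apply: gxy; apply: toC_inj; move: Rexy Imxy.
    by case: (toC _) (toC _) => [a b] [c d] /=; rewrite !mul0r !mul1r !sub0r => -> /oppr_inj ->.
  exists (fun x => complex.Re (toC (g x))) => //.
  by exists (fun x => toC (g x)) => //; exact: span_gen.
by exists F.
Qed.

End SpanDensity.

(** * Means of characters on the space of sequences *)

Section HspaceMeans.
Variable R : realType.
Local Notation T1 := (circle R).
Local Notation Hprod := {ptws nat -> {ptws T1 -> T1}}.
Local Notation T := (@Tmap R).
Implicit Types (h : Hspace R) (x : nat -> T1).

Definition ev h k (y : T1) : T1 := (val h : Hprod) k y.

Lemma evM h k : {morph ev h k : y z / (y * z)%g}.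
Proof. by case: (set_mem (valP h)) => hM _ _; exact: hM. Qed.

Lemma ev0 h y : ev h 0 y = y.
Proof. by case: (set_mem (valP h)) => _ h0 _; rewrite /ev h0. Qed.

Lemma ev_T0 h y : ev (T h) 0 y = ev h 0 y.
Proof. by []. Qed.

Lemma ev_TS h k y : ev (T h) k.+1 y = (ev h k y * ev h k.+1 y)%g.
Proof. by []. Qed.

Lemma continuous_ev k y : continuous (fun h => ev h k y).
Proof.
move=> h; apply: (@continuous_comp _ _ _ (set_val : Hspace R -> Hprod) (eval_at k y)).
  exact: initial_continuous.
exact: continuous_eval_at.
Qed.

(** By Pascal's rule its image under [T^a] has the power map with exponent [C(a, k)] as [k]-th
    entry. *)
Definition base_seq : Hprod := fun k => if k is 0%N then id else fun=> 1%g.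

Lemma base_seq_Hset : Hset base_seq.
Proof.
split=> //.
  by case=> [|k] x y //=; rewrite mulg1.
move=> k x k0 _; case: k k0 => // k _ /=.
rewrite big_nat_cond big1 // => j /andP[/andP[j0 _] _].
by case: j j0.
Qed.

Definition base_point : Hspace R := exist _ base_seq (mem_set base_seq_Hset).

Lemma ev_iter_base_point a k y : ev (iter a T base_point) k y = (y ^+ 'C(a, k))%g.
Proof.
elim: a k => [|a IH] [|k].
- by rewrite ev0 bin0 expg1.
- by rewrite bin0n expg0.
- by rewrite ev0 bin0 expg1.
- by rewrite iterS ev_TS !IH binS -expgnDr addnC.
Qed.

Lemma horner_falling_poly m a : (falling_poly m).[a%:R] = (a ^_ m)%:R :> int.
Proof.
elim: m => [|m IH]; first by rewrite /falling_poly big_ord0 hornerC.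
rewrite falling_polyS hornerM IH !hornerE ffactnSr natrM.
have [ma|am] := leqP m a; first by rewrite natrB.
by rewrite ffact_small// !mul0r.
Qed.

(** Where an endomorphism acts as the integer [a], a polynomial in it acts as the value at [a];
    applied to falling factorials this produces the binomial exponents. *)
Lemma heval_pow (psi : T1 -> T1) (p : {poly int}) (w : T1) a :
  {morph psi : y z / (y * z)%g} -> psi w = (w ^+ a)%g ->
  heval psi p w = expgz w p.[a%:R].
Proof.
move=> psiM wa; rewrite /heval horner_coef.
rewrite big_mkord; elim/big_rec2: _ => // j z y _ ->.
rewrite expgzD (iter_torsion_hom _ _ psiM wa); congr (_ * _)%g.
apply: toC_inj; rewrite !toC_expgz toCX exprnP exprz_exp; congr (_ ^ _).
by rewrite mulrC -natz natrX.
Qed.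

(* On the finite group of [d]-torsion points a sequence in the space acts as
   some point of the forward orbit of the base point. *)
Lemma ev_torsion h d K : (0 < d)%N -> exists a, forall k y, (k <= K)%N ->
  (y ^+ d = 1)%g -> ev h k y = (y ^+ 'C(a, k))%g.
Proof.
(* The defining relation controls [phi_k] only on [k!]-th powers. Every [d]-torsion point is the
   [k!]-th power of some [M]-torsion [w], and one generator [y] of the [M]-torsion supplies the same
   [a] for all of these. *)
move=> d0; pose M := (d * K`!)%N.
have M0 : (0 < M)%N by rewrite muln_gt0 d0 fact_gt0.
pose y : T1 := circle_cis (2 * pi * ratr M%:R^-1).
have yM : M.-primitive_root (toC y) by exact: prim_root_cis.
have y1 : (y ^+ M = 1)%g by apply: toC_inj; rewrite toCX (prim_expr_order yM).
have [a _ ya] := torsion_hom (evM h 1) M0 y1.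
exists a => k z kK zd; have [-> |k0] := posnP k; first by rewrite ev0 bin0 expg1.
have zM : toC z ^+ M = 1 by rewrite -toCX /M expgnA zd expg1n.
have [c zc] := prim_rootP yM zM.
have Kc : (K`! %| c)%N.
  rewrite -(@dvdn_pmul2l d)// -/M (prim_order_dvd yM) mulnC exprM -zc -toCX zd.
  exact: eqxx.
have kfK : (k`! %| K`!)%N.
  by apply/dvdnP; exists ('C(K, k) * (K - k)`!)%N; rewrite -(bin_fact kK) mulnA mulnAC.
have /dvdnP[b cb] := dvdn_trans kfK Kc.
pose w := (y ^+ b)%g.
have -> : z = (w ^+ k`!)%g.
  by apply: toC_inj; rewrite zc cb /w -expgnA toCX.
have wa : ev h 1 w = (w ^+ a)%g by rewrite /w (homX (evM h 1)) ya -!expgnA mulnC.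
have wQ : circleQ w.
  by apply/circleQP; exists M => //; rewrite /w -expgnA mulnC expgnA y1 expg1n.
have [_ _ /(_ k w k0 wQ)] := set_mem (valP h).
rewrite -(heval_falling _ (evM h 1) k0) (heval_pow _ (evM h 1) wa).
rewrite horner_falling_poly natz => hk.
by rewrite -(expgnA w) (mulnC k`!) bin_ffact.
Qed.

(** For [i = 0] this is the character multiplying the values [phi_k (x_k)]. Lowering all indices by
    [i] gives its [i]-th iterated coboundary, since [T] multiplies [phi_k] by [phi_(k-1)]. *)
Definition hchar x K i h : T1 := (\prod_(i <= k < K) ev h (k - i) (x k))%g.

Lemma hchar_family x K : phase_family T (hchar x K).
Proof.
move=> i h; rewrite /hchar.
have [Ki|iK] := leqP K i.
  by rewrite !big_geq ?mulg1// ltnW.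
rewrite [in LHS]big_ltn// [in RHS]big_ltn// !subnn ev_T0 -mulgA.
congr (_ * _)%g; rewrite -big_split /=.
apply: eq_big_nat => k /andP[ik _].
have -> : (k - i)%N = (k - i.+1).+1 by lia.
by rewrite ev_TS circle_mulgC.
Qed.

Lemma hchar_base_point x K i : (i < K)%N -> hchar x K i base_point = x i.
Proof.
move=> iK; rewrite /hchar big_ltn// subnn ev0 big_nat_cond big1 ?mulg1//.
move=> k /andP[/andP[ik _] _].
by have -> : (k - i)%N = (k - i.+1).+1 by lia.
Qed.

(** Evaluation at the base point reads off the [x k], so torsion of the coboundaries is torsion of
    the [x k]. For the window sum, [h] acts on the finitely many torsion [x k] as a point of the
    forward orbit of the base point, along which the sum is constant. *)
Lemma hchar_constant_mean x K :
  constant_mean T (fun h => toC (hchar x K 0 h)).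
Proof.
apply: (@phase_family_constant_mean _ _ _ _ K (hchar_family x K)).
- by move=> i h Ki; rewrite /hchar big_geq// ltnW.
- move=> j d d0 Fd.
  have xd k : (j < k < K)%N -> (x k ^+ d = 1)%g.
    by move=> /andP[jk kK]; rewrite -(hchar_base_point x kK) Fd.
  have [Kj|jK] := leqP K j.
    by right; exists 1%N => // h; rewrite /hchar big_geq.
  have Fj h : (hchar x K j h ^+ d = x j ^+ d)%g.
    rewrite /hchar big_ltn// subnn ev0 circle_expgM.
    rewrite -[RHS]mulg1; congr (_ * _)%g.
    rewrite (big_morph (fun z : T1 => z ^+ d)%g (fun a b => circle_expgM a b d) (expg1n _ d)).
    rewrite big_nat_cond big1// => k /andP[jk _].
    by rewrite -(homX (evM h _)) xd// (hom1 (evM h _)).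
  have [[e e0 xe]|nt] := pselect (exists2 e, (0 < e)%N & (x j ^+ e)%g = 1%g).
    right; exists (d * e)%N; first by rewrite muln_gt0 d0.
    by move=> h; rewrite expgnA Fj -expgnA mulnC expgnA xe expg1n.
  left=> h e e0 Fe; apply: nt; exists (d * e)%N; first by rewrite muln_gt0 d0.
  by rewrite expgnA -(Fj h) -expgnA mulnC expgnA Fe expg1n.
move=> d N d0 Fd N0 FN.
pose S h := \sum_(n < N) toC (hchar x K 0 (iter n T h)).
have Sinv h : S (T h) = S h.
  apply: (@window_invariant _ _ T (fun h => toC (hchar x K 0 h))) => g.
  by rewrite FN.
exists (S base_point) => h.
have [a ha] := ev_torsion h K d0.
have -> : S base_point = S (iter a T base_point).
  by elim: a {ha} => // a IH; rewrite iterS Sinv.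
apply: eq_bigr => n _; congr toC.
(* All [i] are treated together because each step in time brings in the index [i.+1]. *)
suff E i : hchar x K i (iter n T h) = hchar x K i (iter n T (iter a T base_point)) by [].
elim: (nat_of_ord n) i => [|n0 IH] i; last by rewrite !iterS !hchar_family !IH.
apply: eq_big_nat => k /andP[ik kK]; rewrite ev_iter_base_point.
(* [x 0] may be nontorsion, but it only meets [phi_0], the identity at every point. *)
case: k ik kK => [|k] ik kK; first by rewrite ev0 bin0 expg1.
apply: ha; first by lia.
by rewrite -(hchar_base_point x kK) Fd.
Qed.

Lemma continuous_hchar x K : continuous (hchar x K 0).
Proof.
elim: K => [|K IH].
  rewrite (_ : hchar x 0 0 = cst 1%g); first by move=> h; exact: cst_continuous.
  by apply/funext => h; rewrite /hchar big_geq.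
rewrite (_ : hchar x K.+1 0 = fun h => (hchar x K 0 h * ev h K (x K))%g); last first.
  by apply/funext => h; rewrite /hchar big_nat_recr//= subn0.
have c1 : continuous (fun h => toC (hchar x K 0 h)).
  move=> h; apply: (@continuous_comp _ _ _ (hchar x K 0) (@toC R)).
    exact: IH.
  exact: continuous_toC.
have c2 : continuous (fun h => toC (ev h K (x K))).
  move=> h; apply: (@continuous_comp _ _ _ (fun h => ev h K (x K)) (@toC R)).
    exact: continuous_ev.
  exact: continuous_toC.
have c12 : continuous (fun h => toC (hchar x K 0 h) * toC (ev h K (x K))).
  by move=> h; exact: (@cvgM R[i] _ (nbhs h) _ _ _ _ _ (c1 h) (c2 h)).
by apply: continuous_comp_initial; exact: c12.
Qed.

(** Triviality of [x] from [K] on allows [K] to be enlarged, so that two characters can be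
    multiplied at a common length. *)
Definition Hcharacters : set (Hspace R -> T1) :=
  [set g | exists x K, (forall k, (K <= k)%N -> x k = 1%g) /\ g = hchar x K 0].

Lemma hchar_widen x K K' : (K <= K')%N -> (forall k, (K <= k)%N -> x k = 1%g) ->
  hchar x K 0 = hchar x K' 0.
Proof.
move=> KK' x1; apply/funext => h; rewrite /hchar (big_cat_nat (n := K) (p := K'))//=.
rewrite [X in (_ * X)%g]big_nat_cond [X in (_ * X)%g]big1 ?mulg1//.
by move=> k /andP[/andP[Kk _] _]; rewrite x1// (hom1 (evM h _)).
Qed.

Lemma Hspace_approx_mean (f : Hspace R -> R) : continuous f -> has_approx_mean T f.
Proof.
move=> cf; apply: constant_mean_approx => e e0.
have [| | | | |F [n [c [g [Gg ->]]]] fF] :=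
  @span_dense R (Hspace R) Hcharacters (@compact_Hspace R) _ _ _ _ _ f e cf e0.
- by move=> _ [x [K [_ ->]]]; exact: continuous_hchar.
- exists (fun=> 1%g), 0%N; split=> //.
  by apply/funext => h; rewrite /hchar big_geq.
- move=> _ _ [x [K [x1 ->]]] [y [L [y1 ->]]].
  exists (fun k => (x k * y k)%g), (maxn K L); split.
    by move=> k; rewrite geq_max => /andP[Kk Lk]; rewrite x1// y1// mulg1.
  rewrite (hchar_widen (leq_maxl K L) x1) (hchar_widen (leq_maxr K L) y1).
  apply/funext => h; rewrite /hchar -big_split /=.
  by apply: eq_bigr => k _; rewrite evM.
- move=> _ [x [K [x1 ->]]]; exists (fun k => (x k)^-1%g), K; split.
    by move=> k Kk; rewrite x1// invg1.
  apply/funext => h; rewrite /hchar.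
  rewrite (big_morph (fun z : T1 => z^-1)%g (id1 := 1%g) (op1 := *%g)) ?invg1//.
    by apply: eq_bigr => k _; rewrite (homV (evM h _)).
  by move=> a b; apply: toC_inj; rewrite !(toCV, toCM) rmorphM.
- move=> h h' hh'.
  have [k [y hy]] : exists k y, ev h k y <> ev h' k y.
    apply: contrapT => nE; apply: hh'; apply: val_inj; apply/funext => k.
    apply/funext => y; apply: contrapT => hy; apply: nE; by exists k, y.
  exists (hchar (fun j => if j == k then y else 1%g) k.+1 0).
    by exists (fun j => if j == k then y else 1%g), k.+1; split=> // j kj; rewrite gtn_eqF.
  suff E (g : Hspace R) : hchar (fun j => if j == k then y else 1%g) k.+1 0 g = ev g k y.
    by rewrite !E.
  rewrite /hchar big_nat_recr//= eqxx subn0 big_nat_cond big1 ?mul1g//.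
  by move=> j /andP[/andP[_ jk] _]; rewrite ltn_eqF// (hom1 (evM g _)).
exists (fun h => \sum_(i < n) c i * toC (g i h)) => //.
apply: (@constant_mean_comb _ _ _ _ _ (fun i h => toC (g i h))) => i.
by have [x [K [_ ->]]] := Gg i; exact: hchar_constant_mean.
Qed.

End HspaceMeans.

Lemma has_approx_mean_factor (R : realType) (X Y : Type) (s : X -> X) (t : Y -> Y)
    (p : X -> Y) (f : Y -> R) : range p = setT -> (forall x, p (s x) = t (p x)) ->
  has_approx_mean s (f \o p) -> has_approx_mean t f.
Proof.
move=> pY ps fM e e0; have [c fc] := fM e e0; exists c => y.
have [x _ <-] : range p y by rewrite pY.
have [N0 h] := fc x; exists N0 => N /h.
rewrite /birkhoff_sum; congr (`|_ - _| <= _).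
apply: eq_bigr => n _ /=; congr f.
by elim: (n : nat) => // k IH; rewrite !iterS -IH ps.
Qed.

Theorem theorem4p11 (R : realType) :
  (forall (Y : ptopologicalType) (t : Y -> Y),
     dynamical_system t -> is_factor (@Tmap R) t -> uniquely_ergodic R t) /\
  (forall (X : ptopologicalType) (s : X -> X),
     dynamical_system s -> minimal_system s -> quasi_discrete_spectrum R s ->
     uniquely_ergodic R s).
Proof.
split=> [Y t tY [p [cp pY ps]]|X s sX minX qds].
  apply: mean_uniquely_ergodic => // f cf.
  apply: (has_approx_mean_factor pY ps); apply: Hspace_approx_mean => h.
  by apply: continuous_comp; [exact: cp | exact: cf].
apply: mean_uniquely_ergodic => //; apply: quasi_discrete_approx_mean => //.
by case: sX => _ _ [].
Qed.
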